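(* Let $n\ge2$, let $\Omega\subset\mathbb R^n$ be a bounded open set with $\Omega_e:=\mathbb R^n\setminus\overline\Omega$, let $0<s<1$, and let $q\in L^\infty(\Omega)$ satisfy $q\ge0$ a.e. in $\Omega$. Let $\psi$ be quasicontinuous in $\Omega$. Let $f_0\in H^s(\mathbb R^n)$ satisfy $f_0\ge0$ q.e. in $\Omega_e$, be supported in $\Omega_e$, and be not identically zero. Assume that, for every $t\in\mathbb Q_+=\{t\in\mathbb Q:t>0\}$, the admissible set $\mathcal K_{tf_0,\psi}$ is nonempty, and let $u_t$ be the corresponding obstacle solution (exterior datum $tf_0$, obstacle $\psi$, potential $q$). If the quasicontinuous function $\psi$ is finite a.e. in $\Omega$, then $$\Omega=\bigcup_{t\in\mathbb Q_+}\{x\in\Omega:u_t(x)>\psi(x)\}\quad\text{up to a Lebesgue null set}.$$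
   Context: Sobolev space: $H^s(\mathbb R^n)$ has norm $\|u\|_{H^s(\mathbb R^n)}^2=\|u\|_{L^2(\mathbb R^n)}^2+\iint_{\mathbb R^n\times\mathbb R^n}\frac{|u(x)-u(y)|^2}{|x-y|^{n+2s}}\,dx\,dy$, and $\widetilde H^s(\Omega)$ is the closure of $C_c^\infty(\Omega)$ in $H^s(\mathbb R^n)$. Bilinear form: $\mathcal E_s(u,v)=\frac{c_{n,s}}2\iint_{\mathbb R^n\times\mathbb R^n}\frac{(u(x)-u(y))(v(x)-v(y))}{|x-y|^{n+2s}}\,dx\,dy$, where $c_{n,s}>0$ is the constant for which $(-\Delta)^s u(x)=c_{n,s}\,\mathrm{p.v.}\int_{\mathbb R^n}\frac{u(x)-u(y)}{|x-y|^{n+2s}}dy$ has Fourier multiplier $|\xi|^{2s}$; and $\mathcal B_q(u,v)=\mathcal E_s(u,v)+\int_\Omega quv\,dx$. Capacity: for compact $K$, $\mathrm{Cap}_s(K)=\inf\{\|v\|_{H^s(\mathbb R^n)}^2: v\in\mathcal S(\mathbb R^n),\ v\ge1\text{ on }K\}$; for open $G$, $\mathrm{Cap}_s(G)=\sup\{\mathrm{Cap}_s(K):K\subset G\text{ compact}\}$; for arbitrary $E$, $\mathrm{Cap}_s(E)=\inf\{\mathrm{Cap}_s(G):E\subset G\text{ open}\}$. ''q.e.'' means outside a set of zero $\mathrm{Cap}_s$. A function $g$ defined q.e. in $\mathbb R^n$ (resp. in $\Omega$) is quasicontinuous (resp. quasicontinuous in $\Omega$) if for each $\varepsilon>0$ there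 is an open $G$ with $\mathrm{Cap}_s(G)<\varepsilon$ such that $g|_{\mathbb R^n\setminus G}$ (resp. $g|_{\Omega\setminus G}$) is continuous. Every $u\in H^s(\mathbb R^n)$ has a quasicontinuous representative, unique up to sets of zero capacity; pointwise statements refer to it. Obstacle solution: for $f\in H^s(\mathbb R^n)$, $\mathcal K_{f,\psi}=\{v\in H^s(\mathbb R^n): v-f\in\widetilde H^s(\Omega),\ v\ge\psi\text{ q.e. in }\Omega\}$. If $q\ge0$ and $\mathcal K_{f,\psi}\neq\emptyset$, the obstacle solution with exterior datum $f$, obstacle $\psi$ and potential $q$ is the unique $u\in\mathcal K_{f,\psi}$ with $\mathcal B_q(u,v-u)\ge0$ for all $v\in\mathcal K_{f,\psi}$. *)

(* Defs.v *)
From HB Require Import structures.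
From mathcomp Require Import all_boot all_order all_algebra.
From mathcomp Require Import all_classical all_reals all_analysis.
From mathcomp Require Import complex.

Set Implicit Arguments.
Unset Strict Implicit.
Unset Printing Implicit Defensive.

Import Order.TTheory GRing.Theory Num.Theory.
Import numFieldNormedType.Exports.

Local Open Scope classical_set_scope.
Local Open Scope ring_scope.

(* R^n is ['rV[R]_n], with the topology and the vector space structure of the
  library.  Its sigma-algebra is generated by the coordinates, as the library
  does for tuples; it is the Borel sigma-algebra. *)

Definition rV_display : measure_display -> measure_display.
Proof. exact. Qed.

Section measurable_rV.
Context {d} {T : sigmaRingType d} (n : nat).

Let coord (i : 'I_n) (x : 'rV[T]_n) : T := x ord0 i.

Let rV_set0 : g_sigma_preimage coord set0.
Proof. exact: sigma_algebra0. Qed.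

Let rV_setC A : g_sigma_preimage coord A -> g_sigma_preimage coord (~` A).
Proof. exact: sigma_algebraC. Qed.

Let rV_bigcup (F : _^nat) : (forall i, g_sigma_preimage coord (F i)) ->
  g_sigma_preimage coord (\bigcup_i F i).
Proof. exact: sigma_algebra_bigcup. Qed.

HB.instance Definition _ := @isMeasurable.Build (rV_display d)
  'rV[T]_n (g_sigma_preimage coord) rV_set0 rV_setC rV_bigcup.

End measurable_rV.

Lemma measurable_coord d (T : measurableType d) n (i : 'I_n) :
  measurable_fun [set: 'rV[T]_n] (fun x : 'rV[T]_n => x ord0 i).
Proof.
move=> _ Y mY; rewrite setTI; apply: sub_sigma_algebra => /=.
rewrite -bigcup_seq/=; exists i => /=; first by rewrite mem_index_enum.
by exists Y => //; rewrite setTI.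
Qed.

Lemma measurable_fun_coordP d1 d2 (T1 : measurableType d1)
    (T2 : measurableType d2) n (f : T1 -> 'rV[T2]_n) :
  (forall i, measurable_fun [set: T1] (fun x => f x ord0 i)) ->
  measurable_fun [set: T1] f.
Proof.
move=> mf _ Y mY; rewrite setTI; move: Y mY.
pose G := [set Y : set 'rV[T2]_n | measurable (f @^-1` Y)].
suff : <<s \big[setU/set0]_(i < n) preimage_set_system setT
    (fun x : 'rV[T2]_n => x ord0 i) measurable >> `<=` G by exact.
apply: smallest_sub.
  split => [|A GA|F GF]; rewrite /G /=.
  - by rewrite preimage_set0.
  - by rewrite setTD preimage_setC; exact: measurableC.
  - rewrite preimage_bigcup.
    by apply: bigcup_measurable => k _; exact: GF.
rewrite -bigcup_seq => A [i _ [B mB <-]]; rewrite /G/= setTI.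
by have := mf i measurableT B mB; rewrite setTI.
Qed.

Section lebesgue_rV.
Context {R : realType}.

Section step.
Context (n : nat).

(* [measurableTypeR R] is [R] with the display of the library's
   [lebesgue_measure]; the sigma-algebra is the same. *)
Definition rV_cons (p : measurableTypeR R * 'rV[R]_n) : 'rV[R]_n.+1 :=
  \row_i (if unlift ord0 i is Some j then p.2 ord0 j else p.1).

Definition rV_uncons (x : 'rV[R]_n.+1) : measurableTypeR R * 'rV[R]_n :=
  (x ord0 ord0, \row_j x ord0 (lift ord0 j)).

Lemma rV_consK : cancel rV_cons rV_uncons.
Proof.
move=> [a x]; rewrite /rV_uncons /rV_cons; congr pair.
  by rewrite mxE unlift_none.
by apply/rowP => j; rewrite !mxE liftK.
Qed.

Lemma measurable_rV_cons : measurable_fun setT rV_cons.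
Proof.
apply: measurable_fun_coordP => i; case: (unliftP ord0 i) => [j ->|->].
  rewrite (_ : (fun _ => _) = (fun x : 'rV[R]_n => x ord0 j) \o snd).
    by apply: measurableT_comp => //; exact: measurable_coord.
  by apply/funext => x; rewrite /= mxE liftK.
rewrite (_ : (fun _ => _) = (idfun : measurableTypeR R -> R) \o fst).
  have mid : measurable_fun setT (idfun : measurableTypeR R -> R).
    by move=> _ A mA; rewrite setTI.
  exact: measurableT_comp mid _.
by apply/funext => x; rewrite /= mxE unlift_none.
Qed.

Lemma measurable_rV_uncons : measurable_fun setT rV_uncons.
Proof.
apply/measurable_fun_pairP; split; first exact: (@measurable_coord _ R).
apply: measurable_fun_coordP => i.
rewrite (_ : (fun _ => _) = (fun x : 'rV[R]_n.+1 => x ord0 (lift ord0 i))).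
  exact: measurable_coord.
by apply/funext => x; rewrite /= mxE.
Qed.

Variable m : {sigma_finite_measure set 'rV[R]_n -> \bar R}.

Definition lebesgue_step : set 'rV[R]_n.+1 -> \bar R :=
  pushforward (@lebesgue_measure R \x m)%E rV_cons.

Let mpre (A : set 'rV[R]_n.+1) : measurable A ->
  measurable (rV_cons @^-1` A).
Proof.
by move=> mA; rewrite -[X in measurable X]setTI; exact: measurable_rV_cons.
Qed.

Let lebesgue_step0 : lebesgue_step set0 = 0%E.
Proof. by rewrite /lebesgue_step /pushforward preimage_set0 measure0. Qed.

Let lebesgue_step_ge0 A : (0 <= lebesgue_step A)%E.
Proof.
exact: (measure_ge0 (@lebesgue_measure R \x m)%E (rV_cons @^-1` A)).
Qed.

Let lebesgue_step_sigma_additive : semi_sigma_additive lebesgue_step.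
Proof.
move=> F mF tF mUF; rewrite /lebesgue_step /pushforward preimage_bigcup.
apply: measure_semi_sigma_additive.
- by move=> k; exact: mpre.
- apply/trivIsetP => i j _ _ ij; rewrite -preimage_setI.
  by move/trivIsetP : tF => /(_ _ _ _ _ ij) ->//; rewrite preimage_set0.
- by rewrite -preimage_bigcup; exact: mpre.
Qed.

HB.instance Definition _ := isMeasure.Build _ _ _ lebesgue_step
  lebesgue_step0 lebesgue_step_ge0 lebesgue_step_sigma_additive.

Let lebesgue_step_sigma_finite : sigma_finite setT lebesgue_step.
Proof.
have /sigma_finiteP[F [TF ndF Foo]] := sigma_finiteT (@lebesgue_measure R).
have /sigma_finiteP[G [TG ndG Goo]] := sigma_finiteT m.
exists (fun k => rV_uncons @^-1` (F k `*` G k)).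
  apply/esym; rewrite -subTset => x _.
  have [i _ Fi] : (\bigcup_i F i) (rV_uncons x).1 by rewrite -TF.
  have [j _ Gj] : (\bigcup_i G i) (rV_uncons x).2 by rewrite -TG.
  exists (maxn i j) => //; split.
    by move: Fi; exact/subsetPset/ndF/leq_maxl.
  by move: Gj; exact/subsetPset/ndG/leq_maxr.
move=> k; have [mF Fkoo] := Foo k; have [mG Gkoo] := Goo k; split.
  rewrite -[X in measurable X]setTI; apply: measurable_rV_uncons => //.
  exact: measurableX.
rewrite /lebesgue_step /pushforward -comp_preimage.
rewrite (_ : rV_uncons \o rV_cons = id); last first.
  by apply/funext => x; exact: rV_consK.
by rewrite preimage_id product_measure1E// lte_mul_pinfty// ge0_fin_numE.
Qed.

HB.instance Definition _ := @Measure_isSigmaFinite.Build _ _ _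
  lebesgue_step lebesgue_step_sigma_finite.

End step.

Fixpoint lebesgue_rV (n : nat) : {sigma_finite_measure set 'rV[R]_n -> \bar R} :=
  match n with
  | 0 => dirac (0 : 'rV[R]_0)
  | n'.+1 => lebesgue_step (lebesgue_rV n')
  end.

Lemma lebesgue_rV_box n (A : 'I_n -> set R) : (forall i, measurable (A i)) ->
  lebesgue_rV n [set x | forall i, A i (x ord0 i)] =
  (\prod_(i < n) @lebesgue_measure R (A i))%E.
Proof.
elim: n A => [|n IH] A mA.
  rewrite big_ord0 /= diracE mem_set//.
  by move=> [].
have mB : measurable [set y : 'rV[R]_n | forall j, A (lift ord0 j) (y ord0 j)].
  rewrite (_ : mkset _ = \bigcap_(j in [set: 'I_n])
      ((fun y : 'rV[R]_n => y ord0 j) @^-1` A (lift ord0 j))); last first.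
    by apply/seteqP; split => y /= yA j => [_|]; exact: yA.
  apply: fin_bigcap_measurable => // j _.
  by rewrite -[X in measurable X]setTI; exact: measurable_coord.
rewrite big_ord_recl -IH// -product_measure1E//; last exact: mA.
rewrite /= /lebesgue_step /pushforward; congr (product_measure1 _ _ _).
apply/seteqP; split => -[a y] /=.
  move=> aA; split => [|j].
    by have := aA ord0; rewrite mxE unlift_none.
  by have := aA (lift ord0 j); rewrite mxE liftK.
move=> [Aa Ay] i; rewrite mxE.
by case: (unliftP ord0 i) => [j ->|->].
Qed.

End lebesgue_rV.
Arguments lebesgue_rV : clear implicits.

Section smooth.
Context {R : realType} (n : nat).
Implicit Types u : 'rV[R]_n -> R.

(* The norm of the library on ['rV_n] is the sup norm. *)
Definition enorm (x : 'rV[R]_n) : R := Num.sqrt (\sum_i x ord0 i ^+ 2).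

Definition partial (i : 'I_n) u : 'rV[R]_n -> R :=
  fun x => 'D_(delta_mx ord0 i) u x.

Definition partials (l : seq 'I_n) u : 'rV[R]_n -> R := foldr partial u l.

Definition smooth u := forall l : seq 'I_n,
  continuous (partials l u) /\
  forall (i : 'I_n) x, derivable (partials l u) x (delta_mx ord0 i).

Definition Cc_smooth (Omega : set 'rV[R]_n) : set ('rV[R]_n -> R) :=
  [set u | [/\ smooth u, compact (closure [set x | u x != 0]) &
               closure [set x | u x != 0] `<=` Omega]].

Definition schwartz : set ('rV[R]_n -> R) :=
  [set u | smooth u /\ forall (k : nat) (l : seq 'I_n),
     exists C : R, forall x, (1 + enorm x) ^+ k * `|partials l u x| <= C].

End smooth.

Section fractional_laplacian.
Context {R : realType} (n : nat).
Local Notation mu := (lebesgue_rV R n).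
Implicit Types (u : 'rV[R]_n -> R) (s c : R).

Definition fractional_laplacian s c u (x : 'rV[R]_n) : R :=
  c * lim ((fun e : R => \int[mu]_(y in [set y | e < enorm (x - y)])
             ((u x - u y) / enorm (x - y) `^ (n%:R + 2 * s))) @ 0^'+).

Definition dotp (x y : 'rV[R]_n) : R := \sum_i x ord0 i * y ord0 i.

(* The integral of e^(- i x.xi) u(x). *)
Definition fourier u (xi : 'rV[R]_n) : R[i] :=
  Complex (\int[mu]_x (u x * cos (dotp x xi)))
          (- \int[mu]_x (u x * sin (dotp x xi))).

(* [c] is c_(n,s): with it, (-Delta)^s has Fourier multiplier |xi|^(2s). *)
Definition fractional_laplacian_constant s c := 0 < c /\
  forall u, schwartz u -> forall xi,
    fourier (fractional_laplacian s c u) xi =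
    Complex (enorm xi `^ (2 * s)) 0 * fourier u xi.

End fractional_laplacian.

(* Elements of H^s are given by Borel functions, to be read up to null sets;
   pointwise statements about them go through [quasicontinuous_rep] below. *)

Section sobolev.
Context {R : realType} (n : nat) (s : R).
Local Notation mu := (lebesgue_rV R n).
Implicit Types (u v f q : 'rV[R]_n -> R) (Omega : set 'rV[R]_n).

Definition Hs_normsq u : \bar R :=
  (\int[mu]_x ((u x) ^+ 2)%:E +
   \int[(mu \x mu)]_z ((u z.1 - u z.2) ^+ 2 /
                       enorm (z.1 - z.2) `^ (n%:R + 2 * s))%:E)%E.

Definition Hs : set ('rV[R]_n -> R) :=
  [set u | measurable_fun setT u /\ (Hs_normsq u < +oo)%E].

Definition Hs_tilde Omega : set ('rV[R]_n -> R) :=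
  [set u | Hs u /\ forall e : R, 0 < e ->
     exists2 phi, Cc_smooth Omega phi & (Hs_normsq (u \- phi)%R < (e ^+ 2)%:E)%E].

Definition cap_compact (K : set 'rV[R]_n) : \bar R :=
  ereal_inf [set Hs_normsq v | v in
    [set v | schwartz v /\ forall x, K x -> 1 <= v x]].

Definition cap_open (G : set 'rV[R]_n) : \bar R :=
  ereal_sup [set cap_compact K | K in [set K | compact K /\ K `<=` G]].

Definition cap (E : set 'rV[R]_n) : \bar R :=
  ereal_inf [set cap_open G | G in [set G | open G /\ E `<=` G]].

Definition qe_in (A : set 'rV[R]_n) (P : 'rV[R]_n -> Prop) : Prop :=
  exists2 N, cap N = 0%E & forall x, A x -> ~ N x -> P x.

Definition quasicontinuous_in (A : set 'rV[R]_n) (T : topologicalType)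
    (g : 'rV[R]_n -> T) : Prop :=
  forall e : R, 0 < e -> exists G : set 'rV[R]_n,
    [/\ open G, (cap_open G < e%:E)%E & {within A `\` G, continuous g}].

(* [g] is not required to be Borel. *)
Definition quasicontinuous_rep u (g : 'rV[R]_n -> R) : Prop :=
  quasicontinuous_in setT g /\ {ae mu, forall x, g x = u x}.

Definition ess_support u : set 'rV[R]_n :=
  ~` \bigcup_(U in [set U | open U /\ {ae mu, forall x, U x -> u x = 0}]) U.

Definition energy (c : R) u v : R :=
  c / 2 * \int[(mu \x mu)%E]_z ((u z.1 - u z.2) * (v z.1 - v z.2) /
                                enorm (z.1 - z.2) `^ (n%:R + 2 * s)).

Definition bilinear_form (c : R) Omega q u v : R :=
  energy c u v + \int[mu]_(x in Omega) (q x * u x * v x).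

(* The obstacle may take infinite values; the quasicontinuous representative
   is unique up to sets of zero capacity. *)
Definition admissible Omega f (psi : 'rV[R]_n -> \bar R) :
    set ('rV[R]_n -> R) :=
  [set v | [/\ Hs v, Hs_tilde Omega (v \- f) &
     exists2 g, quasicontinuous_rep v g &
       qe_in Omega (fun x => (psi x <= (g x)%:E)%E)]].

Definition obstacle_solution (c : R) Omega q f psi u : Prop :=
  admissible Omega f psi u /\
  forall v, admissible Omega f psi v ->
    0 <= bilinear_form c Omega q u (v \- u).

End sobolev.

(* Main.v *)
Require Import Defs.
From mathcomp Require Import all_boot all_order all_algebra.
From mathcomp Require Import all_classical all_reals all_analysis.
From mathcomp Require Import measurable_realfun ess_sup_inf.
From mathcomp Require Import ring lra.

Set Implicit Arguments.
Unset Strict Implicit.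
Unset Printing Implicit Defensive.

Import Order.TTheory GRing.Theory Num.Theory.
Import numFieldNormedType.Exports.

Local Open Scope classical_set_scope.
Local Open Scope ring_scope.

(** The solution [u_t] is a nonnegative supersolution: testing with
  [v = u_t + phi], [phi >= 0] smooth with compact support in [Omega], gives
  [B_q(u_t, phi) >= 0].  Since [u_t - t f0] is a limit of such smooth [phi_k],
  the composites [G o phi_k] with a smooth Lipschitz [G] are themselves legal
  test functions, so no mollification is needed; passing to the limit by
  dominated convergence one may test with functions of [u_t - t f0], which is
  [u_t] in [Omega].  The negative part gives [u_t >= 0].  The function
  [eta^2 / (1 + u_t + u_t^2)], with a cutoff [eta], gives, as in the nonlocal
  logarithmic estimate,
    [t * iint f0(y) eta(x)^2 / (1 + u_t(x) + u_t(x)^2) |x - y|^(-n-2s) <= C]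
  with [C] independent of [t].  Hence the set where [u_t <= m] for all [t] is
  null for every [m], and outside [\bigcup_t {u_t > psi}] all the [u_t] are
  bounded by the finite number [psi(x)]. *)

(** * Cubes and Borel sets *)

(** A competitor must lie above the obstacle quasi-everywhere, while H^s controls functions only
    almost everywhere. Adding a smooth nonnegative function with compact support in Omega visibly
    preserves the quasicontinuous representative and the constraint; this dictates the class of
    direct tests. The price is that a function of u_t - t f0 is reached only as a limit of G o
    phi_k, for which convergence in H^s is not claimed. Instead the phi_k are chosen to converge
    fast, so that their squares and Gagliardo integrands have common integrable majorants; a
    Lipschitz G, with the cutoff if there is one, changes these only in a controlled way, and each
    integral passes to the limit by itself.

    Nonnegativity precedes the barrier estimate because r -> 1/(1 + r + r^2) is not monotone on
    negative r, and the pairwise inequalities fail there. The bound is uniform in t because t f0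
    lives where the test function vanishes: it enters the energy linearly and with one sign, while
    the remaining terms are controlled by u/(1 + u + u^2) <= 1 and a Cauchy-Schwarz inequality whose
    right side is free of u. *)

Section cubes.
Context {R : realType} (n : nat).
Implicit Types (p x : 'rV[R]_n) (r : R) (A : set 'rV[R]_n).

Definition cube p r : set 'rV[R]_n :=
  [set x | forall i, `|x ord0 i - p ord0 i| <= r].

Lemma cube_itv p r : cube p r =
  [set x | forall i, [set` `[p ord0 i - r, p ord0 i + r]%R] (x ord0 i)].
Proof.
by apply/seteqP; split => x /= + i => /(_ i); rewrite in_itv/= ler_distl.
Qed.

Lemma measurable_cube p r : measurable (cube p r).
Proof.
rewrite (_ : cube p r = \bigcap_(i in [set: 'I_n])
  ((fun x : 'rV[R]_n => x ord0 i) @^-1` `[p ord0 i - r, p ord0 i + r]%classic)).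
  apply: fin_bigcap_measurable => // i _.
  rewrite -[X in measurable X]setTI.
  apply: (@measurable_coord _ R n i); first exact: measurableT.
  exact: measurable_itv.
by rewrite cube_itv; apply/seteqP; split => x /= xA i => [_|]; exact: xA.
Qed.

Lemma compact_cube p r : compact (cube p r).
Proof.
rewrite cube_itv.
apply: (@rV_compact R n (fun i => `[p ord0 i - r, p ord0 i + r]%classic)) => i.
exact: segment_compact.
Qed.

Lemma lebesgue_cube p r : 0 <= r ->
  lebesgue_rV R n (cube p r) = ((2 * r) ^+ n)%:E.
Proof.
move=> r0; rewrite cube_itv.
rewrite (lebesgue_rV_box (A := fun i => `[p ord0 i - r, p ord0 i + r]%classic));
  last by move=> i; exact: measurable_itv.
rewrite (eq_bigr (fun=> (2 * r)%:E)); last first.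
  move=> i _; rewrite lebesgue_measure_itv/= lte_fin.
  have -> : ((p ord0 i + r)%:E - (p ord0 i - r)%:E = (2 * r)%:E)%E.
    by rewrite -EFinB; congr EFin; ring.
  case: ltP => // h.
  have -> : r = 0 by apply/eqP; rewrite eq_le r0 andbT; lra.
  by rewrite mulr0.
rewrite big_const_ord; elim: {p}n => // k /= ->.
by rewrite -EFinM exprS.
Qed.

(* Codes that are not those of a pair give the one-point cube at 0. *)
Definition rat_cube (k : nat) : 'rV[R]_n * R :=
  if unpickle k is Some (p, r)
  then (map_mx (fun a : rat => ratr a) p, ratr r) else (0, 0).

(** A rational half-side r below e/2 and a rational centre within r of x keep the cube in the
    sup-norm ball of radius e. The bound on x is strict so that [cube_bump] is positive at x. *)
Lemma rat_cube_nbhs A x : open A -> A x -> exists k,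
  [/\ forall i, `|x ord0 i - (rat_cube k).1 ord0 i| < (rat_cube k).2 &
      cube (rat_cube k).1 (rat_cube k).2 `<=` A].
Proof.
move=> oA Ax.
have /nbhs_ballP[e /= e0 eA] : nbhs x A by exact: open_nbhs_nbhs.
have [r /[!in_itv]/= /andP[r0 re]] : exists r : rat, ratr r \in `]0, e / 2[.
  by apply: rat_in_itvoo; rewrite divr_gt0.
have /choice[p px] : forall i, exists q : rat,
    `|x ord0 i - ratr q| < ratr r :> R.
  move=> i; have [|q] := @rat_in_itvoo R (x ord0 i - ratr r) (x ord0 i + ratr r).
    lra.
  by rewrite in_itv/= => qx; exists q; rewrite distrC ltr_distl.
exists (pickle (\row_i p i, r)); rewrite /rat_cube pickleK; split => [i|y yp].
  by rewrite !mxE.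
apply: eA; split => // i j; rewrite ord1 /ball/=.
have := px j; have := yp j; rewrite !mxE => h1 h2.
rewrite (le_lt_trans (ler_distD (ratr (p j)) _ _))//.
by rewrite [X in _ + X]distrC; move: h1 h2 re => /=; lra.
Qed.

Lemma open_bigcup_cube A : open A -> A =
  \bigcup_(k in [set k | cube (rat_cube k).1 (rat_cube k).2 `<=` A])
     cube (rat_cube k).1 (rat_cube k).2.
Proof.
move=> oA; apply/seteqP; split => [x Ax|x [k /= kA xk]]; last exact: kA.
have [k [xk kA]] := rat_cube_nbhs oA Ax.
by exists k => // i; rewrite ltW.
Qed.

Lemma open_measurable_rV A : open A -> measurable A.
Proof.
move=> /open_bigcup_cube ->; apply: bigcup_measurable => k _.
exact: measurable_cube.
Qed.

Lemma closed_measurable_rV A : closed A -> measurable A.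
Proof.
move=> cA; rewrite -[A]setCK; apply: measurableC.
by apply: open_measurable_rV; exact: closed_openC.
Qed.

Lemma continuous_measurable_rV (f : 'rV[R]_n -> R) :
  continuous f -> measurable_fun setT f.
Proof.
move=> cf; apply: (measurability _ (RGenOpens.measurableE R)) => _ [_ [a [b ->] <-]].
rewrite setTI; apply: open_measurable_rV.
by apply: open_comp => //; exact: interval_open.
Qed.

(** Inner regularity: an open set is the increasing union of finite unions of the rational cubes it
    contains, these are compact, and the measure is continuous from below. *)
Lemma open_le_measure_compact A (e : \bar R) : open A ->
  (forall K, compact K -> K `<=` A -> (lebesgue_rV R n K <= e)%E) ->
  (lebesgue_rV R n A <= e)%E.
Proof.
move=> oA Ae.
pose F k := if `[< cube (rat_cube k).1 (rat_cube k).2 `<=` A >]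
  then cube (rat_cube k).1 (rat_cube k).2 else set0.
pose G k := \big[setU/set0]_(j < k.+1) F j.
have mF k : measurable (F k).
  by rewrite /F; case: ifP => _ //; exact: measurable_cube.
have mG k : measurable (G k) by exact: bigsetU_measurable.
have AG : A = \bigcup_k G k.
  rewrite /G bigcup_bigsetU_bigcup [LHS](open_bigcup_cube oA).
  apply/seteqP; split => x [k]; rewrite /F.
    by move=> /= kA xk; exists k => //=; rewrite asboolT.
  by move=> _; case: asboolP => //= kA xk; exists k.
have ndG : nondecreasing_seq G by move=> k l kl; apply/subsetPset; exact: subset_bigsetU.
rewrite AG.
have /cvg_lim <- // := nondecreasing_cvg_mu (mu := lebesgue_rV R n)
  mG (bigcup_measurable (fun k _ => mG k)) ndG.
apply: lime_le.
  by apply: ereal_nondecreasing_is_cvgn => k l kl; apply: le_measure; rewrite ?inE//;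
    exact/subsetPset/ndG.
near=> k; apply: Ae.
  rewrite /G; elim/big_ind : _ => //; first exact: compact0.
    by move=> ? ? ? ?; exact: compactU.
  move=> j _; rewrite /F; case: ifP => _; [exact: compact_cube|exact: compact0].
by rewrite AG; exact: bigcup_sup.
Unshelve. all: by end_near. Qed.

End cubes.

Arguments rat_cube {R} n k.

(** * Sets of zero capacity are null *)

Section capacity.
Context {R : realType} (n : nat) (s : R).
Local Notation mu := (lebesgue_rV R n).
Implicit Types (u v f : 'rV[R]_n -> R) (A N : set 'rV[R]_n).

Lemma smooth_continuous v : smooth v -> continuous v.
Proof. by move=> /(_ [::])[]. Qed.

Lemma sqr_integral_le_Hs_normsq v :
  (\int[mu]_x ((v x) ^+ 2)%:E <= Hs_normsq s v)%E.
Proof.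
rewrite /Hs_normsq leeDl//; apply: integral_ge0 => z _.
by rewrite lee_fin divr_ge0// ?sqr_ge0 ?powR_ge0.
Qed.

(** Chebyshev's inequality: a competitor v is at least 1 on the compact set, so the measure is at
    most the integral of v^2. *)
Lemma measure_le_cap_compact A : compact A -> (mu A <= cap_compact s A)%E.
Proof.
move=> cA; have mA : measurable A.
  by apply: closed_measurable_rV; apply: compact_closed => //; exact: norm_hausdorff.
apply/ereal_infP => _ [v [[sv _] v1] <-].
have mv := continuous_measurable_rV (smooth_continuous sv).
apply: le_trans (sqr_integral_le_Hs_normsq v).
have mv2 : measurable_fun setT (fun x => ((v x) ^+ 2)%:E).
  by apply/measurable_EFinP; exact: measurable_funX.
apply: (@le_trans _ _ (\int[mu]_(x in A) ((v x) ^+ 2)%:E)%E); last first.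
  by apply: ge0_subset_integral => // x _; rewrite lee_fin sqr_ge0.
rewrite -[leLHS]mul1e -integral_cst//; apply: ge0_le_integral => //=.
- exact: measurable_funS mv2.
- by move=> x Ax; rewrite lee_fin -(expr1n _ 2) lerXn2r// ?nnegrE ?(le_trans ler01) ?v1.
Qed.

Lemma measure_le_cap_open A : open A -> (mu A <= cap_open s A)%E.
Proof.
move=> oA; apply: open_le_measure_compact => // K cK KA.
apply: le_trans (measure_le_cap_compact cK) _.
by apply: ereal_sup_ubound; exists K.
Qed.

(** Open supersets of capacity below 1/(k+1) have measure at most 1/(k+1); their intersection is a
    measurable null superset, N itself being arbitrary. *)
Lemma cap0_negligible N : cap s N = 0%E -> mu.-negligible N.
Proof.
move=> N0.
have /choice[G GP] k : exists G, [/\ open G, N `<=` G & (mu G <= k.+1%:R^-1%:E)%E].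
  have : (cap s N < k.+1%:R^-1%:E)%E by rewrite N0 lte_fin invr_gt0.
  move=> /ereal_inf_lt[_ [G [oG NG] <-]] Gk; exists G; split => //.
  exact: le_trans (measure_le_cap_open oG) (ltW Gk).
exists (\bigcap_k G k); split.
- by apply: bigcapT_measurable => k; apply: open_measurable_rV; have [] := GP k.
- apply/eqP; rewrite -measure_le0; apply/lee_addgt0Pr => e e0; rewrite add0e.
  have [k ke] : exists k, k.+1%:R^-1 < e :> R.
    by have [k] := ltr_add_invr e0; rewrite add0r; exists k.
  have [oG _ Gk] := GP k.
  apply: (@le_trans _ _ (mu (G k))); last first.
    by apply: le_trans Gk _; rewrite lee_fin ltW.
  apply: le_measure; rewrite ?inE.
  + by apply: bigcapT_measurable => j; apply: open_measurable_rV; have [] := GP j.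
  + exact: open_measurable_rV.
  + exact: bigcap_inf.
- by apply: sub_bigcap => k _; have [] := GP k.
Qed.

Lemma qe_in_ae A (P : 'rV[R]_n -> Prop) : qe_in s A P ->
  {ae mu, forall x, A x -> P x}.
Proof.
move=> [N /cap0_negligible N0 AP]; apply: negligibleS N0 => x /=.
by move=> nP; apply: contrapT => nN; apply: nP => Ax; exact: AP.
Qed.

(** The complement of the support is an uncountable union of open sets on which f vanishes almost
    everywhere; the rational cubes reduce it to a countable one. *)
Lemma ess_support_ae f : {ae mu, forall x, ~ ess_support f x -> f x = 0}.
Proof.
pose C k : set 'rV[R]_n := cube (rat_cube n k).1 (rat_cube n k).2.
pose D := [set k | {ae mu, forall x : 'rV[R]_n,
  C k x -> f x = 0}].
pose N (k : nat) := [set x | D k /\ C k x /\ f x <> 0].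
apply: (@negligibleS _ _ _ mu (\bigcup_k N k)); last first.
  apply: negligible_bigcup => k; have [Dk|nDk] := pselect (D k).
    by apply: negligibleS Dk => x [_ [xk fx]] /= /(_ xk).
  have -> : N k = set0 by apply/seteqP; split => // x [].
  exact: negligible_set0.
move=> x /= /not_implyP[+ fx]; rewrite /ess_support/= => /contrapT[U [oU U0] Ux].
have [k [xk kU]] := rat_cube_nbhs oU Ux.
exists k => //; split; last by split => // i; rewrite ltW.
by apply: filterS U0 => y fU /kU; exact: fU.
Qed.

End capacity.

(** * Smooth functions *)

Section directional_derivative.
Context {R : realType} {V : normedModType R}.
Implicit Types (u v : V -> R) (x w : V).

Lemma is_derive_line u x w b :
  is_derive x w u b <-> is_derive (0 : R) (1 : R) (fun h : R => u (h *: w + x)) b.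
Proof.
have E : 'D_w u x = 'D_1 (fun h : R => u (h *: w + x)) 0.
  rewrite /derive; congr (lim (_ @ 0^')); apply/funext => h /=.
  by rewrite scale0r add0r addr0 [h *: 1]mulr1.
split=> -[d db]; split; [exact: (derivable1P u x w).1 d|by rewrite -E|
  exact: (derivable1P u x w).2 d|by rewrite E].
Qed.

(** Restriction to the line through x in direction w leaves the one-variable chain rule; of u only a
    directional derivative is assumed, not differentiability. *)
Lemma is_derive_comp_line (h : R -> R) u x w a b :
  is_derive (u x) 1 h a -> is_derive x w u b -> is_derive x w (h \o u) (a * b).
Proof.
move=> ha /is_derive_line ub; apply/is_derive_line.
apply: (is_derive1_comp (f := h) (g := fun h0 : R => u (h0 *: w + x))).
by rewrite scale0r add0r.
Qed.

End directional_derivative.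

Lemma is_derive_exprn {R : realType} (m : nat) (y : R) :
  is_derive y 1 (fun y => y ^+ m) (m%:R * y ^+ m.-1).
Proof.
have := @is_deriveX R R id m y 1 1 (is_derive_id y 1).
by rewrite exprfctE [_ *: _]mulr1.
Qed.

Section smooth_functions.
Context {R : realType} (n : nat).
Implicit Types (u v : 'rV[R]_n -> R) (x : 'rV[R]_n) (k : nat).

(** Recursion on the order lets the product and composition rules be proved by induction on k, for
    which the lists of directions in [smooth] are unsuited. *)
Fixpoint class_C k u : Prop := continuous u /\
  if k is k'.+1 then forall i : 'I_n,
    (forall x, derivable u x (delta_mx ord0 i)) /\ class_C k' (partial i u)
  else True.

Lemma class_C_continuous k u : class_C k u -> continuous u.
Proof. by case: k => [|k] []. Qed.

Arguments class_C_continuous : clear implicits.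

Lemma smoothP u : smooth u <-> forall k, class_C k u.
Proof.
split=> [su k|Cu].
  elim: k u su => [|k IH] u su.
    by split => //; have [] := su [::].
  split; first by have [] := su [::].
  move=> i; split => [x|]; first by have [_] := su [::]; exact.
  (* [class_C] peels off the derivative that is applied first, which is the last entry of the
     list. *)
  by apply: IH => l; rewrite /partials -foldr_rcons; exact: su.
suff H l k : class_C k (partials l u).
  move=> l; split; first by have [] := H l 0%N.
  by move=> i x; have [_ /(_ i)[+ _]] := H l 1%N; exact.
elim: l k => [|i l IH] k //=.
by have [_ /(_ i)[]] := IH k.+1.
Qed.

Lemma class_CW k u : class_C k.+1 u -> class_C k u.
Proof.
elim: k u => [|k IH] u [cu du]; first by split.
by split => // i; have [dui Cui] := du i; split => //; exact: IH.
Qed.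

Lemma class_CS k u : continuous u ->
  (forall i : 'I_n, exists2 v, (forall x, is_derive x (delta_mx ord0 i) u (v x)) &
     class_C k v) -> class_C k.+1 u.
Proof.
move=> cu H; split => // i; have [v uv Cv] := H i; split; first by move=> x; have [] := uv x.
by rewrite (_ : partial i u = v)//; apply/funext => x; exact: derive_val.
Qed.

Lemma class_C_is_derive k u (i : 'I_n) x : class_C k.+1 u ->
  is_derive x (delta_mx ord0 i) u (partial i u x).
Proof. by move=> [_ /(_ i)[du _]]; exact: derivableP. Qed.

Lemma class_C_partial k u (i : 'I_n) : class_C k.+1 u -> class_C k (partial i u).
Proof. by move=> [_ /(_ i)[]]. Qed.

Lemma class_C_cst k (a : R) : class_C k (cst a).
Proof.
elim: k a => [|k IH] a; first by split => // x; exact: cst_continuous.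
apply: class_CS; first by move=> x; exact: cst_continuous.
move=> i; exists (cst 0); last exact: IH.
by move=> x; exact: is_derive_cst.
Qed.

Lemma class_CD k u v : class_C k u -> class_C k v -> class_C k (u \+ v).
Proof.
elim: k u v => [|k IH] u v Cu Cv.
  split => // x.
  exact (continuousD (class_C_continuous _ _ Cu x) (class_C_continuous _ _ Cv x)).
apply: class_CS => [x|i].
  exact (continuousD (class_C_continuous _ _ Cu x) (class_C_continuous _ _ Cv x)).
exists (partial i u \+ partial i v) => [x|].
  exact: (is_deriveD (class_C_is_derive i x Cu) (class_C_is_derive i x Cv)).
by apply: IH; exact: class_C_partial.
Qed.

Lemma class_CM k u v : class_C k u -> class_C k v -> class_C k (u \* v).
Proof.
elim: k u v => [|k IH] u v Cu Cv.
  split => // x.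
  exact (continuousM (class_C_continuous _ _ Cu x) (class_C_continuous _ _ Cv x)).
apply: class_CS => [x|i].
  exact (continuousM (class_C_continuous _ _ Cu x) (class_C_continuous _ _ Cv x)).
exists ((u \* partial i v) \+ (v \* partial i u)) => [x|].
  exact: (is_deriveM (class_C_is_derive i x Cu) (class_C_is_derive i x Cv)).
by apply: class_CD; apply: IH; (exact: class_C_partial || exact: class_CW).
Qed.

(* [h] is a family of functions closed under differentiation, up to linear
  combinations, on a set [D] containing the values of [u]. *)
Lemma class_C_comp (I : Type) (h : I -> R -> R) (D : set R) k u :
  (forall j (y : R), D y -> {for y, continuous (h j)}) ->
  (forall j, exists l : seq (R * I), forall y : R, D y ->
     is_derive y 1 (h j) (\sum_(p <- l) p.1 * h p.2 y)) ->
  (forall x, D (u x)) -> class_C k u -> forall j, class_C k (h j \o u).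
Proof.
move=> ch dh Du; elim: k => [|k IH] Cu j.
  split => // x; apply: continuous_comp; first exact (class_C_continuous _ _ Cu x).
  exact: ch.
apply: class_CS => [x|i].
  apply: continuous_comp; first exact (class_C_continuous _ _ Cu x).
  exact: ch.
have [l hl] := dh j.
exists ((fun x => \sum_(p <- l) p.1 * h p.2 (u x)) \* partial i u) => [x|].
  apply: is_derive_comp_line; first exact: hl.
  exact: (class_C_is_derive i x Cu).
apply: class_CM; last exact: class_C_partial.
elim: l {hl} => [|[a j'] l IHl].
  under eq_fun do rewrite big_nil; exact: class_C_cst.
under eq_fun do rewrite big_cons /=.
apply: class_CD => //; apply: class_CM; first exact: class_C_cst.
by apply: IH; exact: class_CW.
Qed.

Lemma smooth_cst (a : R) : smooth (cst a : 'rV[R]_n -> R).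
Proof. by apply/smoothP => k; exact: class_C_cst. Qed.

Lemma smoothD u v : smooth u -> smooth v -> smooth (u \+ v).
Proof. by move=> /smoothP Cu /smoothP Cv; apply/smoothP => k; exact: class_CD. Qed.

Lemma smoothM u v : smooth u -> smooth v -> smooth (u \* v).
Proof. by move=> /smoothP Cu /smoothP Cv; apply/smoothP => k; exact: class_CM. Qed.

Lemma smooth_comp (I : Type) (h : I -> R -> R) (D : set R) u j :
  (forall j (y : R), D y -> {for y, continuous (h j)}) ->
  (forall j, exists l : seq (R * I), forall y : R, D y ->
     is_derive y 1 (h j) (\sum_(p <- l) p.1 * h p.2 y)) ->
  (forall x, D (u x)) -> smooth u -> smooth (h j \o u).
Proof. move=> ch dh Du /smoothP Cu; apply/smoothP => k.
exact: (class_C_comp ch dh Du (Cu k) j). Qed.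

Lemma smoothV u : (forall x, 0 < u x) -> smooth u -> smooth (fun x => (u x)^-1).
Proof.
move=> u0 su.
have := @smooth_comp nat (fun m y => (y ^+ m.+1)^-1) [set y | 0 < y] u 0%N.
apply => //.
- move=> m x /= x0; apply: cvgV; first by rewrite expf_neq0// gt_eqF.
  exact: exprn_continuous.
- move=> m; exists [:: (- m.+1%:R, m.+1)] => x /= x0.
  rewrite big_seq1 /=; apply: is_derive_eq.
    apply: (@is_deriveV _ (fun y => y ^+ m.+1)); first by rewrite expf_neq0// gt_eqF.
    exact: is_derive_exprn.
  rewrite /GRing.scale /= !exprS.
  by field; rewrite expf_neq0// gt_eqF.
Qed.

(** The powers y^(1/2 - m) are closed under differentiation up to the scalar 1/2 - m; the square
    root is the member m = 0. *)
Lemma smooth_sqrt u : (forall x, 0 < u x) -> smooth u ->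
  smooth (fun x => Num.sqrt (u x)).
Proof.
move=> u0 su.
rewrite (_ : (fun _ => _) = (fun y => Num.sqrt y * (y ^+ 0)^-1) \o u); last first.
  by apply/funext => x /=; rewrite expr0 invr1 mulr1.
apply: (@smooth_comp nat (fun m y => Num.sqrt y * (y ^+ m)^-1) [set y | 0 < y] u 0%N) => //.
- move=> m x /= x0; apply: cvgM; first exact: sqrt_continuous.
  apply: cvgV; first by rewrite expf_neq0// gt_eqF.
  exact: exprn_continuous.
- move=> m; exists [:: (2^-1 - m%:R, m.+1)] => x /= x0.
  rewrite big_seq1 /=; apply: is_derive_eq.
    apply: (@is_deriveM _ _ Num.sqrt (fun y => (y ^+ m)^-1)).
      exact: is_derive1_sqrt.
    apply: (@is_deriveV _ (fun y => y ^+ m)); first by rewrite expf_neq0// gt_eqF.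
    exact: is_derive_exprn.
  rewrite /GRing.scale /=.
  have sx : Num.sqrt x != 0 by rewrite gt_eqF// sqrtr_gt0.
  have -> : (2 * Num.sqrt x)^-1 = 2^-1 * Num.sqrt x / x.
    by rewrite -{3}(sqr_sqrtr (ltW x0)); field.
  case: m => [|m].
    by rewrite expr1 expr0; field; rewrite gt_eqF.
  by rewrite !exprS /=; field; rewrite expf_neq0// gt_eqF.
Qed.

End smooth_functions.

(** * Flat functions and smooth bumps on cubes *)

Section flat.
Context {R : realType}.
Implicit Types (m : nat) (y : R).

(** For m = 0 the classical smooth function exp(-1/y) extended by 0. The factors y^(-m) make the
    family closed under differentiation up to linear combinations. *)
Definition flat m y : R := if 0 < y then (y ^+ m)^-1 * expR (- y^-1) else 0.

(** For y > 0 this is exp z >= z^(m+1)/(m+1)! at z = 1/y. The linear bound yields continuity at 0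
    for every m. *)
Lemma flat_le m y : `|flat m y| <= (m.+1)`!%:R * `|y|.
Proof.
rewrite /flat; case: ltP => y0; last by rewrite normr0 mulr_ge0.
have z0 : 0 < y^-1 by rewrite invr_gt0.
rewrite !ger0_norm ?mulr_ge0 ?invr_ge0 ?exprn_ge0 ?expR_ge0 ?(ltW y0)//.
rewrite expRN ler_pdivrMr ?expR_gt0// -ler_pdivrMl ?mulr_gt0 ?ltr0n ?fact_gt0//.
have := expR_ge1Dxn m (ltW z0); apply: le_trans.
rewrite ler_wpDl//= exprVn exprS.
rewrite le_eqVlt; apply/orP; left; apply/eqP; field.
by rewrite expf_neq0 ?gt_eqF//= pnatr_eq0 -lt0n fact_gt0.
Qed.

Lemma is_derive_flat m y :
  is_derive y 1 (flat m) (flat m.+2 y - m%:R * flat m.+1 y).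
Proof.
have [y0|y0|y0] := ltgtP 0 y.
- pose g y := (y ^+ m)^-1 * expR (- y^-1).
  apply: (@near_eq_is_derive _ _ _ g).
    by near=> z; rewrite /flat ifT//; near: z; exact: lt_nbhsr.
  have yn0 : y != 0 by rewrite gt_eqF.
  have ymn0 k : y ^+ k != 0 by rewrite expf_neq0.
  apply: is_derive_eq.
    apply: (@is_deriveM _ _ (fun y => (y ^+ m)^-1) (fun y => expR (- y^-1))).
      by apply: (@is_deriveV _ (fun y => y ^+ m)) => //; exact: is_derive_exprn.
    apply: (@is_derive1_comp _ expR (fun y => - y^-1)).
    apply: (@is_deriveN _ _ _ (fun y => y^-1)).
    exact: (@is_deriveV _ id).
  rewrite /flat y0 /GRing.scale /=.
  by case: m g ymn0 => [|m] _ ymn0; rewrite /= !exprS; field; rewrite ?yn0 ?ymn0.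
- rewrite /flat !ltNge (ltW y0) /= mulr0 subr0.
  apply: (@near_eq_is_derive _ _ _ (cst 0)).
    near=> z; rewrite /cst ifF//; apply/negbTE; rewrite -leNgt ltW//.
    by near: z; exact: lt_nbhsl.
(* Since [flat m z] is z times [flat m.+1 z], the difference quotient at 0 is [flat m.+1], which
   tends to 0 by [flat_le]. *)
- rewrite -y0; apply/is_derive1_caratheodory; exists (flat m.+1).
  have f0 k : flat k 0 = 0 by rewrite /flat ltxx.
  split; last by rewrite !f0 mulr0 subr0.
    move=> z; rewrite f0 !subr0 /flat; case: ltP => z0; last by rewrite mul0r.
    by rewrite exprS; field; rewrite expf_neq0 ?gt_eqF.
  rewrite /prop_for /continuous_at f0; apply/cvgr0Pnorm_le => e e0; near=> z.
  apply: le_trans (flat_le _ _) _.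
  rewrite -ler_pdivlMl ?ltr0n ?fact_gt0//.
  near: z; apply/nbhs_ballP; exists ((m.+2)`!%:R^-1 * e) => /=.
    by rewrite mulr_gt0// invr_gt0 ltr0n fact_gt0.
  by move=> z; rewrite /ball/= sub0r normrN => /ltW.
Unshelve. all: by end_near. Qed.

Lemma flat_continuous m : continuous (flat m).
Proof.
move=> y; apply/differentiable_continuous/derivable1_diffP.
by have [] := is_derive_flat m y.
Qed.

Lemma flat_ge0 m y : 0 <= flat m y.
Proof.
rewrite /flat; case: ltP => // y0.
by rewrite mulr_ge0 ?invr_ge0 ?exprn_ge0 ?expR_ge0 ?ltW.
Qed.

Lemma flat0_le1 y : flat 0 y <= 1.
Proof.
rewrite /flat; case: ltP => // y0.
by rewrite expr0 invr1 mul1r expR_le1 oppr_le0 invr_ge0 ltW.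
Qed.

Lemma flat_gt0 m y : (0 < flat m y) = (0 < y).
Proof.
rewrite /flat; case: ifPn => y0; last by rewrite ltxx.
by rewrite mulr_gt0 ?invr_gt0 ?exprn_gt0 ?expR_gt0.
Qed.

Lemma flat2_le2 y : flat 2 y <= 2.
Proof.
rewrite /flat; case: ltP => // y0.
rewrite expRN ler_pdivrMr ?expR_gt0//.
have := @expR_ge1Dxn R y^-1 1; rewrite invr_ge0 (ltW y0) => /(_ isT).
by rewrite exprVn /= (_ : 2`! = 2)//; lra.
Qed.

Lemma flat0_lipschitz (a b : R) : `|flat 0 a - flat 0 b| <= 2 * `|a - b|.
Proof.
wlog ab : a b / b <= a => [H|].
  by have [/H//|/ltW/H] := leP b a; rewrite distrC [`|b - a|]distrC.
have [||c _ ->] := @MVT_segment _ (flat 0) (flat 2) b a ab.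
  move=> c _; have := is_derive_flat 0 c; rewrite mul0r subr0; exact.
  by apply: continuous_subspaceT => z; exact: flat_continuous.
by rewrite normrM ler_wpM2r// ger0_norm ?flat_ge0 ?flat2_le2.
Qed.

Lemma prod_lipschitz (I : Type) (l : seq I) (F G : I -> R) (e : R) :
  (forall i, `|F i| <= 1) -> (forall i, `|G i| <= 1) ->
  (forall i, `|F i - G i| <= e) ->
  `|\prod_(i <- l) F i - \prod_(i <- l) G i| <= (size l)%:R * e.
Proof.
move=> F1 G1 FG; elim: l => [|i l IH]; first by rewrite !big_nil subrr normr0 mul0r.
rewrite !big_cons /= -natr1 mulrDl mul1r.
have -> : F i * \prod_(j <- l) F j - G i * \prod_(j <- l) G j =
  F i * (\prod_(j <- l) F j - \prod_(j <- l) G j) + (F i - G i) * \prod_(j <- l) G j.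
  by ring.
apply: le_trans (ler_normD _ _) _; rewrite !normrM; apply: lerD.
  by rewrite -[leRHS]mul1r ler_pM.
rewrite -[leRHS]mulr1 ler_pM// normr_prod.
by apply: prodr_ile1 => j _; rewrite normr_ge0 G1.
Qed.

End flat.

Section bump.
Context {R : realType} (n : nat).
Implicit Types (p x : 'rV[R]_n) (r : R).

Lemma is_derive_coord (i : 'I_n) x (w : 'rV[R]_n) :
  is_derive x w (fun x : 'rV[R]_n => x ord0 i) (w ord0 i).
Proof.
apply/is_derive_line.
rewrite (_ : (fun _ => _) = (fun h : R => h * w ord0 i + x ord0 i)); last first.
  by apply/funext => h; rewrite !mxE.
by apply: is_derive_eq; rewrite /GRing.scale/= mul0r add0r addr0 mulr1.
Qed.

Lemma smooth_coord (i : 'I_n) : smooth (fun x : 'rV[R]_n => x ord0 i).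
Proof.
apply/smoothP => -[|k]; first by split => // x; exact: coord_continuous.
apply: class_CS; first by move=> x; exact: coord_continuous.
move=> j; exists (cst ((delta_mx ord0 j : 'rV[R]_n) ord0 i)); last exact: class_C_cst.
by move=> x; exact: is_derive_coord.
Qed.

Lemma smooth_flat m (u : 'rV[R]_n -> R) : smooth u -> smooth (flat m \o u).
Proof.
move=> su; apply: (@smooth_comp _ _ nat flat setT) => //.
  by move=> j y _; exact: flat_continuous.
move=> j; exists [:: (1, j.+2); (- j%:R, j.+1)] => y _.
by rewrite big_cons big_seq1/= mul1r mulNr; exact: is_derive_flat.
Qed.

Lemma smooth_prod (I : Type) (l : seq I) (F : I -> 'rV[R]_n -> R) :
  (forall i, smooth (F i)) -> smooth (fun x => \prod_(i <- l) F i x).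
Proof.
move=> sF; elim: l => [|i l IH].
  by under eq_fun do rewrite big_nil; exact: smooth_cst.
by under eq_fun do rewrite big_cons; exact: (smoothM (sF i) IH).
Qed.

Definition cube_bump p r x :=
  \prod_i (flat 0 (x ord0 i - (p ord0 i - r)) * flat 0 (p ord0 i + r - x ord0 i)).

Lemma smooth_cube_bump p r : smooth (cube_bump p r).
Proof.
apply: smooth_prod => i; apply: smoothM; apply: smooth_flat.
  by apply: smoothD; [exact: smooth_coord|exact: smooth_cst].
rewrite (_ : (fun _ => _) = (fun x : 'rV[R]_n =>
  (p ord0 i + r) + (cst (-1) \* (fun x : 'rV[R]_n => x ord0 i)) x)); last first.
  by apply/funext => x /=; rewrite mulN1r.
apply: smoothD; first exact: smooth_cst.
by apply: smoothM; [exact: smooth_cst|exact: smooth_coord].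
Qed.

Lemma cube_bump_ge0 p r x : 0 <= cube_bump p r x.
Proof. by apply: prodr_ge0 => i _; rewrite mulr_ge0 ?flat_ge0. Qed.

Lemma cube_bump_factor_le1 (a b : R) : `|flat 0 a * flat 0 b| <= 1.
Proof.
by rewrite ger0_norm ?mulr_ge0 ?flat_ge0// mulr_ile1 ?flat_ge0 ?flat0_le1.
Qed.

Lemma cube_bump_le1 p r x : cube_bump p r x <= 1.
Proof.
rewrite /cube_bump; apply: prodr_ile1 => i _.
by rewrite mulr_ge0 ?flat_ge0//= mulr_ile1 ?flat_ge0 ?flat0_le1.
Qed.

Lemma cube_bump_gt0 p r x : (forall i, `|x ord0 i - p ord0 i| < r) -> 0 < cube_bump p r x.
Proof.
move=> xp; apply: prodr_gt0 => i _; have := xp i; rewrite ltr_distl => /andP[h1 h2].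
by rewrite mulr_gt0 ?flat_gt0//; lra.
Qed.

Lemma cube_bump_support p r x : cube_bump p r x != 0 -> cube p r x.
Proof.
rewrite /cube_bump => /prodf_neq0 H i; have := H i isT.
rewrite mulf_eq0 negb_or => /andP[].
rewrite ![flat _ _ == 0]eq_le !flat_ge0 !andbT -!ltNge !flat_gt0 => h1 h2.
by rewrite ler_distl; apply/andP; split; lra.
Qed.

(** Each of the n factors is a product of two functions bounded by 1 and 2-Lipschitz by
    [flat0_lipschitz], hence is 4-Lipschitz in its coordinate; the product telescopes. *)
Lemma cube_bump_lipschitz p r x (y : 'rV[R]_n) (d : R) : (forall i, `|x ord0 i - y ord0 i| <= d) ->
  `|cube_bump p r x - cube_bump p r y| <= n%:R * (4 * d).
Proof.
move=> xy; rewrite /cube_bump.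
have := @prod_lipschitz R 'I_n (index_enum 'I_n)
 (fun i => flat 0 (x ord0 i - (p ord0 i - r)) * flat 0 (p ord0 i + r - x ord0 i))
 (fun i => flat 0 (y ord0 i - (p ord0 i - r)) * flat 0 (p ord0 i + r - y ord0 i)) (4 * d).
have -> : size (index_enum 'I_n) = n by rewrite /index_enum -enumT size_enum_ord.
apply => i; try exact: cube_bump_factor_le1.
set a := flat 0 (x _ _ - _); set b := flat 0 (_ - x _ _).
set a' := flat 0 (y _ _ - _); set b' := flat 0 (_ - y _ _).
have -> : a * b - a' * b' = a * (b - b') + (a - a') * b' by ring.
have ha : `|a - a'| <= 2 * d.
  apply: le_trans (flat0_lipschitz _ _) _; rewrite ler_wpM2l//.
  by rewrite [X in `|X|](_ : _ = x ord0 i - y ord0 i)//; ring.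
have hb : `|b - b'| <= 2 * d.
  apply: le_trans (flat0_lipschitz _ _) _; rewrite ler_wpM2l//.
  by rewrite distrC [X in `|X|](_ : _ = x ord0 i - y ord0 i)//; ring.
have a1 : `|a| <= 1 by rewrite ger0_norm ?flat_ge0 ?flat0_le1.
have b1 : `|b'| <= 1 by rewrite ger0_norm ?flat_ge0 ?flat0_le1.
apply: le_trans (ler_normD _ _) _; rewrite !normrM.
have := ler_pM (normr_ge0 _) (normr_ge0 _) a1 hb.
have := ler_pM (normr_ge0 _) (normr_ge0 _) ha b1.
lra.
Qed.

Lemma cube_bump_Cc_smooth p r (A : set 'rV[R]_n) : cube p r `<=` A ->
  Cc_smooth A (cube_bump p r).
Proof.
move=> pA.
have cl : closure [set x | cube_bump p r x != 0] `<=` cube p r.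
  have cc : closed (cube p r).
    by apply: compact_closed; [exact: norm_hausdorff|exact: compact_cube].
  by rewrite closureE; apply: smallest_sub => // x; exact: cube_bump_support.
split; first exact: smooth_cube_bump.
  by apply: subclosed_compact cl; [exact: closed_closure|exact: compact_cube].
exact: subset_trans cl pA.
Qed.

End bump.

(** * The Gagliardo energy *)

Lemma integral_nneseries_lty d (T : measurableType d) (R : realType)
    (mu : {measure set T -> \bar R}) (G : nat -> T -> R) (b : nat -> R) (C : R) :
  (forall j, measurable_fun setT (G j)) -> (forall j z, 0 <= G j z) ->
  (forall j, (\int[mu]_z (G j z)%:E <= (b j)%:E)%E) ->
  (forall k, \sum_(0 <= j < k) b j <= C) ->
  (\int[mu]_z (\sum_(j <oo) (G j z)%:E) < +oo)%E.
Proof.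
move=> mG G0 Gb bC; apply: (@le_lt_trans _ _ C%:E); last exact: ltry.
rewrite integral_nneseries//; last 2 first.
  - by move=> j; apply/measurable_EFinP.
  - by move=> j z _; rewrite lee_fin.
apply: lime_le.
  apply: is_cvg_nneseries => j _ _; apply: integral_ge0 => z _.
  by rewrite lee_fin.
near=> k; apply: (@le_trans _ _ (\sum_(0 <= j < k) (b j)%:E)%E).
  by apply: lee_sum => j _.
by rewrite sumEFin lee_fin.
Unshelve. all: by end_near. Qed.

Lemma measurable_nneseries_EFin d (T : measurableType d) (R : realType)
    (G : nat -> T -> R) :
  (forall j, measurable_fun setT (G j)) -> (forall j z, 0 <= G j z) ->
  measurable_fun setT (fun z => (\sum_(j <oo) (G j z)%:E)%E).
Proof.
move=> mG G0; apply: ge0_emeasurable_sum => [j z _ _|j _].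
  by rewrite lee_fin.
by apply/measurable_EFinP.
Qed.

Lemma le_nneseries_EFin (R : realType) (a : nat -> R) j :
  (forall j, 0 <= a j) -> ((a j)%:E <= \sum_(j <oo) (a j)%:E)%E.
Proof.
move=> a0; apply: le_trans (nneseries_lim_ge j.+1 _); last first.
  by move=> k _ _; rewrite lee_fin.
rewrite big_nat_recr//= leeDr// sume_ge0// => k _.
by rewrite lee_fin.
Qed.

(** This replaces a partition of the domain: each point has only to satisfy one of the bounds [G j],
    and the sum of all of them is a majorant. *)
Lemma integral_lty_series d (T : measurableType d) (R : realType)
    (mu : {measure set T -> \bar R}) (F : T -> R) (G : nat -> T -> R)
    (b : nat -> R) (C : R) :
  measurable_fun setT F -> (forall z, 0 <= F z) ->
  (forall j, measurable_fun setT (G j)) -> (forall j z, 0 <= G j z) ->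
  (forall z, exists j, F z <= G j z) ->
  (forall j, (\int[mu]_z (G j z)%:E <= (b j)%:E)%E) ->
  (forall k, \sum_(0 <= j < k) b j <= C) ->
  (\int[mu]_z (F z)%:E < +oo)%E.
Proof.
move=> mF F0 mG G0 FG Gb bC.
apply: le_lt_trans (integral_nneseries_lty mG G0 Gb bC).
apply: ge0_le_integral => //.
- by move=> z _; rewrite lee_fin.
- by apply/measurable_EFinP.
- exact: measurable_nneseries_EFin.
- move=> z _; have [j Fj] := FG z.
  apply: (@le_trans _ _ (G j z)%:E); first by rewrite lee_fin.
  exact: (@le_nneseries_EFin _ (fun j => G j z)).
Qed.

Lemma dyadic_scale (R : realType) (a : R) : 1 <= a ->
  exists j, 2 ^+ j <= a < 2 ^+ j.+1.
Proof.
move=> a1.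
have ex : exists k, a < 2 ^+ k.
  exists (Num.bound a); apply: lt_le_trans (archi_boundP (le_trans ler01 a1)) _.
  by rewrite -natrX ler_nat ltnW// ltn_expl.
case: (ex_minnP ex) => -[|k] ak kmin; first by move: ak; rewrite expr0 ltNge a1.
exists k; rewrite ak andbT leNgt; apply/negP => /kmin.
by rewrite ltnn.
Qed.

Lemma sum_geometric_le (R : realType) (c rho : R) k : 0 <= c -> 0 <= rho < 1 ->
  \sum_(0 <= j < k) c * rho ^+ j <= c / (1 - rho).
Proof.
move=> c0 /andP[r0 r1]; rewrite -mulr_sumr ler_wpM2l//.
rewrite -[leRHS]mul1r ler_pdivlMr ?subr_gt0// mulrC big_mkord.
have := subrX1 rho k; set S := \sum_(_ < _) _ => h.
have -> : (1 - rho) * S = 1 - rho ^+ k by rewrite -[RHS]opprB h; ring.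
by rewrite lerBlDr lerDl exprn_ge0.
Qed.

(** * Finite energy by dyadic decomposition in the distance of the two points *)

Section gagliardo_kernel.
Context {R : realType} (n : nat) (s : R).
Local Notation mu := (lebesgue_rV R n).
Implicit Types (p x : 'rV[R]_n) (r : R) (z : 'rV[R]_n * 'rV[R]_n).

Definition gagliardo_kernel z : R := (enorm (z.1 - z.2) `^ (n%:R + 2 * s))^-1.

Lemma coord_le_enorm (i : 'I_n) x : `|x ord0 i| <= enorm x.
Proof.
rewrite -sqrtr_sqr; apply: ler_wsqrtr.
by rewrite (bigD1 i)//= lerDl sumr_ge0// => j _; rewrite sqr_ge0.
Qed.

Lemma enorm_ge0 x : 0 <= enorm x.
Proof. exact: sqrtr_ge0. Qed.

Lemma enorm_gt0 x : x != 0 -> 0 < enorm x.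
Proof.
move=> x0; have [i xi] : exists i, x ord0 i != 0.
  apply/existsP; apply: contraNT x0; rewrite negb_exists => /forallP x0.
  by apply/eqP/rowP => i; rewrite mxE; apply/eqP/negPn.
by apply: lt_le_trans (coord_le_enorm i x); rewrite normr_gt0.
Qed.

Lemma gagliardo_kernel_ge0 z : 0 <= gagliardo_kernel z.
Proof. by rewrite invr_ge0 powR_ge0. Qed.

Lemma gagliardo_kernel_gt0 z : z.1 != z.2 -> 0 < gagliardo_kernel z.
Proof. by move=> zz; rewrite invr_gt0 powR_gt0// enorm_gt0// subr_eq0. Qed.

Lemma gagliardo_kernel_le z (i : 'I_n) (d : R) : 0 <= s -> 0 < d ->
  d <= `|z.1 ord0 i - z.2 ord0 i| -> gagliardo_kernel z <= (d `^ (n%:R + 2 * s))^-1.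
Proof.
move=> s0 d0 di; have a0 : 0 <= n%:R + 2 * s by rewrite addr_ge0// mulr_ge0.
have dz : d <= enorm (z.1 - z.2).
  apply: le_trans di (le_trans _ (coord_le_enorm i _)).
  by rewrite !mxE.
rewrite lef_pV2 ?posrE ?powR_gt0//; last exact: lt_le_trans dz.
by apply: ge0_ler_powR => //; rewrite nnegrE ?enorm_ge0// ltW.
Qed.

Lemma measurable_fst_coord (i : 'I_n) :
  measurable_fun setT (fun z : 'rV[R]_n * 'rV[R]_n => z.1 ord0 i).
Proof. exact: (measurableT_comp (@measurable_coord _ R n i) measurable_fst). Qed.

Lemma measurable_snd_coord (i : 'I_n) :
  measurable_fun setT (fun z : 'rV[R]_n * 'rV[R]_n => z.2 ord0 i).
Proof. exact: (measurableT_comp (@measurable_coord _ R n i) measurable_snd). Qed.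

Lemma measurable_gagliardo_kernel : measurable_fun setT gagliardo_kernel.
Proof.
rewrite (_ : gagliardo_kernel = (@powR R ^~ (- (n%:R + 2 * s))) \o
  ((@powR R ^~ 2^-1) \o (fun z => \sum_i (z.1 ord0 i - z.2 ord0 i) ^+ 2))); last first.
  apply/funext => z; rewrite /gagliardo_kernel /= powRN; congr ((_ `^ _)^-1).
  rewrite powR12_sqrt ?sumr_ge0// => [|i _]; last by rewrite sqr_ge0.
  by rewrite /enorm; congr Num.sqrt; apply: eq_bigr => i _; rewrite !mxE.
apply: measurableT_comp; first exact: measurable_powR.
apply: measurableT_comp; first exact: measurable_powR.
apply: measurable_sum => i; apply: measurable_funX; apply: measurable_funB.
  exact: measurable_fst_coord.
exact: measurable_snd_coord.
Qed.

Definition tube p r (d : R) : set ('rV[R]_n * 'rV[R]_n) :=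
  [set z | cube p r z.1 /\ cube z.1 d z.2].

Lemma measurable_tube p r d : measurable (tube p r d).
Proof.
rewrite (_ : tube p r d = (fst @^-1` cube p r) `&`
  \bigcap_(i in [set: 'I_n])
     ((fun z => `|z.2 ord0 i - z.1 ord0 i|) @^-1` `]-oo, d]%classic)); last first.
  apply/seteqP; split => z [] h1 h2; split => //= i.
    by move=> _; rewrite /= in_itv/=; exact: h2.
  by have := h2 i I; rewrite /= in_itv/=.
apply: measurableI.
  rewrite -[X in measurable X]setTI; apply: measurable_fst => //.
  exact: measurable_cube.
apply: fin_bigcap_measurable => // i _.
rewrite -[X in measurable X]setTI.
suff mf : measurable_fun setT
    (fun z : 'rV[R]_n * 'rV[R]_n => `|z.2 ord0 i - z.1 ord0 i|).
  by apply: mf => //; exact: measurable_itv.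
apply: measurableT_comp => //; apply: measurable_funB.
  exact: measurable_snd_coord.
exact: measurable_fst_coord.
Qed.

Lemma integral_tube p r d : 0 <= r -> 0 <= d ->
  (\int[(mu \x mu)]_z (\1_(tube p r d) z)%:E = ((2 * r) ^+ n * (2 * d) ^+ n)%:E)%E.
Proof.
move=> r0 d0.
have mT := measurable_tube p r d.
have mi : measurable_fun setT (EFin \o (\1_(tube p r d) : _ -> R)).
  by apply/measurable_EFinP; exact: measurable_indic.
rewrite fubini_tonelli1//.
rewrite (eq_integral (fun x => ((2 * d) ^+ n)%:E * (\1_(cube p r) x)%:E)%E).
  rewrite ge0_integralZl_EFin//; last 2 first.
  - by apply/measurable_EFinP; apply: measurable_indic; exact: measurable_cube.
  - by rewrite exprn_ge0// mulr_ge0.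
  rewrite integral_indic// ?setIT; last exact: measurable_cube.
  transitivity (((2 * d) ^+ n)%:E * ((2 * r) ^+ n)%:E)%E.
    by congr (_ * _)%E; exact: lebesgue_cube.
  by rewrite -EFinM mulrC.
move=> x _; rewrite /fubini_F.
have [xp|xp] := pselect (cube p r x).
  rewrite (_ : \1_(cube p r) x = 1) ?mule1; last by rewrite indicE mem_set.
  transitivity (\int[mu]_y (\1_(cube x d) y)%:E)%E.
    apply: eq_integral => y _; rewrite /= !indicE; congr (_%:R%:E).
    by congr nat_of_bool; apply/idP/idP; rewrite !inE => // -[].
  rewrite integral_indic// ?setIT; last exact: measurable_cube.
  exact: lebesgue_cube.
rewrite (_ : \1_(cube p r) x = 0) ?mule0; last by rewrite indicE memNset.
rewrite (eq_integral (cst 0%E)) ?integral0// => y _ /=.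
by rewrite indicE memNset// => -[].
Qed.

Lemma integral_swap (f : 'rV[R]_n * 'rV[R]_n -> \bar R) :
  measurable_fun setT f -> (forall z, 0 <= f z)%E ->
  (\int[(mu \x mu)]_z f (z.2, z.1) = \int[(mu \x mu)]_z f z)%E.
Proof.
move=> mf f0.
rewrite fubini_tonelli1//; first by rewrite fubini_tonelli2.
apply: (@measurableT_comp _ _ _ _ _ _ f _ (fun z => (z.2, z.1))) => //.
exact: measurable_swap.
Qed.

(** Symmetrised because a pair on which a function takes different values has at least one point in
    the support, not necessarily the first. *)
Definition tubes p r d z : R := \1_(tube p r d) z + \1_(tube p r d) (z.2, z.1).

Lemma tubes_ge0 p r d z : 0 <= tubes p r d z.
Proof. by rewrite addr_ge0. Qed.

Lemma measurable_tubes p r d : measurable_fun setT (tubes p r d).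
Proof.
apply: measurable_funD; first by apply: measurable_indic; exact: measurable_tube.
apply: (@measurableT_comp _ _ _ _ _ _ (\1_(tube p r d) : _ -> R) _ (fun z => (z.2, z.1))).
  by apply: measurable_indic; exact: measurable_tube.
exact: measurable_swap.
Qed.

Lemma integral_tubes p r d : 0 <= r -> 0 <= d ->
  (\int[(mu \x mu)]_z (tubes p r d z)%:E =
   (2 * ((2 * r) ^+ n * (2 * d) ^+ n))%:E)%E.
Proof.
move=> r0 d0; have mT := measurable_tube p r d.
under eq_integral do rewrite EFinD.
rewrite ge0_integralD//; last 2 first.
- by apply/measurable_EFinP; exact: measurable_indic.
- apply/measurable_EFinP.
  apply: (@measurableT_comp _ _ _ _ _ _ (\1_(tube p r d) : _ -> R) _ (fun z => (z.2, z.1))).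
    exact: measurable_indic.
  exact: measurable_swap.
rewrite (@integral_swap (fun z => (\1_(tube p r d) z)%:E))//; last first.
  by apply/measurable_EFinP; exact: measurable_indic.
transitivity (((2 * r) ^+ n * (2 * d) ^+ n)%:E +
  ((2 * r) ^+ n * (2 * d) ^+ n)%:E)%E.
  by congr (_ + _)%E; exact: integral_tube.
by rewrite -EFinD; congr EFin; rewrite [RHS]mulr_natl mulr2n.
Qed.

Lemma integral_scaled_tubes a p r d : 0 <= a -> 0 <= r -> 0 <= d ->
  (\int[(mu \x mu)]_z (a * tubes p r d z)%:E =
   (a * (2 * ((2 * r) ^+ n * (2 * d) ^+ n)))%:E)%E.
Proof.
move=> a0 r0 d0; under eq_integral do rewrite EFinM.
rewrite ge0_integralZl_EFin//.
- by rewrite integral_tubes.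
- by move=> z _; rewrite lee_fin tubes_ge0.
- by apply/measurable_EFinP; exact: measurable_tubes.
Qed.

Lemma powR_exprn (a b : R) k : 0 <= a -> (a ^+ k) `^ b = (a `^ b) ^+ k.
Proof.
move=> a0; elim: k => [|k IH]; first by rewrite !expr0 powR1.
by rewrite !exprS powRM ?exprn_ge0// IH.
Qed.

(* A pair at sup distance in [2^-(j+1), 2^-j] or [2^j, 2^(j+1)] lies in a tube
  of that size; the two geometric series over [j] converge because [s < 1] and
  [s > 0] respectively. *)
Lemma energy_lty (hs : 0 < s < 1) (phi : 'rV[R]_n -> R) p r (L : R) :
  measurable_fun setT phi -> (forall x, 0 <= phi x <= 1) -> 0 <= r -> 0 <= L ->
  (forall x, phi x != 0 -> cube p r x) ->
  (forall (x y : 'rV[R]_n) (d : R), (forall i, `|x ord0 i - y ord0 i| <= d) ->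
     `|phi x - phi y| <= L * d) ->
  (\int[(mu \x mu)]_z ((phi z.1 - phi z.2) ^+ 2 * gagliardo_kernel z)%:E < +oo)%E.
Proof.
move=> mphi phi01 r0 L0 phis phiL.
have /andP[s0 s1] := hs.
pose theta : R := 2 `^ (n%:R + 2 * s).
have t0 : 0 < theta by rewrite powR_gt0.
have ln2 : 0 < ln 2 :> R by rewrite ln_gt0// ltr1n.
have [s1' s4] : 1 < 2 `^ (2 * s) /\ 2 `^ (2 * s) < 4 :> R.
  split; first by rewrite /powR gt_eqF// expR_gt1 !mulr_gt0.
  have -> : 4 = 2 `^ 2%:R :> R by rewrite powR_mulrn//; ring.
  by rewrite /powR gt_eqF// ltr_expR ltr_pM2r//; lra.
have tE : theta = 2 ^+ n * 2 `^ (2 * s).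
  by rewrite /theta powRD ?powR_mulrn// pnatr_eq0 implybT.
have p2 : 0 < 2 ^+ n :> R by rewrite exprn_gt0.
pose V : R := (2 * r) ^+ n.
have V0 : 0 <= V by rewrite exprn_ge0// mulr_ge0.
(* First term: at sup distance between 2^-(j+1) and 2^-j the squared difference is at most L^2 4^-j
   and the kernel at most theta^(j+1). Second term: at distance between 2^j and 2^(j+1) the squared
   difference is at most 1 and the kernel at most theta^-j. *)
pose G j z := L ^+ 2 * (4^-1 ^+ j) * theta ^+ j.+1 * tubes p r (2^-1 ^+ j) z +
  theta^-1 ^+ j * tubes p r (2 ^+ j.+1) z.
pose c1 := L ^+ 2 * theta * 2 * V * 2 ^+ n.
pose c2 := 2 * V * 4 ^+ n.
(* The ratios are 2^(2s-2) and 2^(-2s): the kernel and difference bounds times the factor 2^-(nj) or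
   2^(nj) from the measure of the tubes. *)
pose rho1 := theta / (4 * 2 ^+ n).
pose rho2 := 2 ^+ n / theta.
have t0' := ltW t0.
have c10 : 0 <= c1 by rewrite /c1 !mulr_ge0// ?sqr_ge0// exprn_ge0.
have c20 : 0 <= c2 by rewrite /c2 !mulr_ge0// exprn_ge0.
have r1 : 0 <= rho1 < 1.
  rewrite divr_ge0 ?mulr_ge0 ?(ltW t0) ?(ltW p2)//=.
  by rewrite ltr_pdivrMr ?mulr_gt0// mul1r tE mulrC ltr_pM2r.
have r2 : 0 <= rho2 < 1.
  rewrite divr_ge0 ?(ltW t0) ?(ltW p2)//=.
  by rewrite ltr_pdivrMr// mul1r tE ltr_pMr.
have mT p' r' d' : measurable_fun setT (EFin \o tubes p' r' d').
  by apply/measurable_EFinP; exact: measurable_tubes.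
apply: (@integral_lty_series _ _ R _ _ G (fun j => c1 * rho1 ^+ j + c2 * rho2 ^+ j)
   (c1 / (1 - rho1) + c2 / (1 - rho2))).
- apply: measurable_funM; last exact: measurable_gagliardo_kernel.
  apply: measurable_funX; apply: measurable_funB.
    exact: (measurableT_comp mphi measurable_fst).
  exact: (measurableT_comp mphi measurable_snd).
- by move=> z; rewrite mulr_ge0 ?sqr_ge0 ?gagliardo_kernel_ge0.
- move=> j; apply: measurable_funD; apply: measurable_funM => //; exact: measurable_tubes.
- move=> j z; rewrite addr_ge0// !mulr_ge0 ?exprn_ge0 ?tubes_ge0 ?invr_ge0//; exact: ltW.
- move=> [x y]; rewrite /G /=.
  have B1 : `|phi x - phi y| <= 1.
    have /andP[x0 x1] := phi01 x; have /andP[y0 y1] := phi01 y.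
    by rewrite ler_distl; apply/andP; split; lra.
  have [->|xy] := eqVneq (phi x) (phi y).
    exists 0%N; rewrite subrr expr0n mul0r.
    by rewrite addr_ge0// !mulr_ge0 ?exprn_ge0 ?tubes_ge0 ?invr_ge0.
  have [i0 i0P] : exists i, 0 < `|x ord0 i - y ord0 i|.
    apply/existsP; apply: contraNT xy; rewrite negb_exists => /forallP H.
    apply/eqP; congr phi; apply/rowP => i; apply/eqP.
    by rewrite -subr_eq0 -normr_le0 leNgt.
  pose i1 := [arg max_(i > i0) `|x ord0 i - y ord0 i|]%O.
  pose d := `|x ord0 i1 - y ord0 i1|.
  have dmax i : `|x ord0 i - y ord0 i| <= d.
    by rewrite /d /i1; case: arg_maxP => // j _; exact.
  have d0 : 0 < d by exact: lt_le_trans (dmax i0).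
  have tubes1 e : d <= e -> 1 <= tubes p r e (x, y).
    move=> de; have dxy i := le_trans (dmax i) de.
    have dyx i : `|y ord0 i - x ord0 i| <= e by rewrite distrC.
    have [px|px] := eqVneq (phi x) 0; last first.
      rewrite /tubes [X in X + _](_ : _ = 1) ?lerDl//.
      by rewrite indicE mem_set//; split => //; exact: phis.
    rewrite /tubes [X in _ + X](_ : _ = 1) ?lerDr//.
    rewrite indicE mem_set//; split => //; apply: phis.
    by rewrite -px eq_sym.
  have a0 : 0 <= n%:R + 2 * s by rewrite addr_ge0// mulr_ge0// ltW.
  have [dle|dge] := leP d 1.
    have [j /andP[j1 j2]] : exists j, 2 ^+ j <= d^-1 < 2 ^+ j.+1.
      by apply: dyadic_scale; rewrite invf_ge1.
    have dj : d <= 2^-1 ^+ j.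
      by rewrite -[d]invrK exprVn lef_pV2 ?posrE ?exprn_gt0// invr_gt0.
    have jd : 2^-1 ^+ j.+1 <= d.
      by rewrite -[d]invrK exprVn lef_pV2 ?posrE ?exprn_gt0 ?invr_gt0// ltW.
    exists j; apply: (@le_trans _ _ (L ^+ 2 * 4^-1 ^+ j * theta ^+ j.+1)); last first.
      rewrite -[leLHS]addr0 lerD//.
        by rewrite ler_peMr ?tubes1// !mulr_ge0 ?sqr_ge0 ?exprn_ge0.
      by rewrite mulr_ge0 ?tubes_ge0 ?exprn_ge0 ?invr_ge0.
    apply: ler_pM; rewrite ?sqr_ge0 ?gagliardo_kernel_ge0//.
      rewrite -real_normK ?num_real//.
      have -> : 4^-1 = 2^-1 ^+ 2 :> R by rewrite exprVn; congr (_^-1); ring.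
      rewrite -exprM mulnC exprM -exprMn lerXn2r ?nnegrE//.
        by rewrite mulr_ge0 ?exprn_ge0 ?invr_ge0.
      by apply: phiL => i; exact: le_trans dj.
    apply: le_trans (gagliardo_kernel_le (z := (x, y)) (i := i1) (ltW s0) _ jd) _.
      by rewrite exprn_gt0 ?invr_gt0.
    rewrite exprVn -powRN -powR_inv1 ?exprn_ge0// -powRrM mulN1r opprK.
    by rewrite powR_exprn.
  have [j /andP[j1 j2]] := dyadic_scale (ltW dge).
  exists j; apply: (@le_trans _ _ (theta^-1 ^+ j)); last first.
    rewrite -[leLHS]add0r lerD//.
      by rewrite !mulr_ge0 ?sqr_ge0 ?exprn_ge0 ?tubes_ge0 ?invr_ge0.
    by rewrite ler_peMr ?tubes1 ?exprn_ge0 ?invr_ge0// ltW.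
  rewrite -[leRHS]mul1r; apply: ler_pM; rewrite ?sqr_ge0 ?gagliardo_kernel_ge0//.
    by rewrite -real_normK ?num_real// expr_le1.
  apply: le_trans (gagliardo_kernel_le (z := (x, y)) (i := i1) (ltW s0) _ j1) _.
    by rewrite exprn_gt0.
  by rewrite powR_exprn// exprVn.
- move=> j; rewrite /G.
  under eq_integral do rewrite EFinD.
  have a1 : 0 <= L ^+ 2 * (4^-1 ^+ j) * theta ^+ j.+1.
    by rewrite !mulr_ge0 ?exprn_ge0 ?invr_ge0// ltW.
  have a2 : 0 <= theta^-1 ^+ j by rewrite exprn_ge0// invr_ge0 ltW.
  rewrite ge0_integralD//; last 4 first.
  + by move=> z _; rewrite lee_fin mulr_ge0 ?tubes_ge0.
  + by apply/measurable_EFinP; apply: measurable_funM => //; exact: measurable_tubes.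
  + by move=> z _; rewrite lee_fin mulr_ge0 ?tubes_ge0.
  + by apply/measurable_EFinP; apply: measurable_funM => //; exact: measurable_tubes.
  apply: (@le_trans _ _ ((L ^+ 2 * 4^-1 ^+ j * theta ^+ j.+1 *
      (2 * ((2 * r) ^+ n * (2 * 2^-1 ^+ j) ^+ n)))%:E +
    (theta^-1 ^+ j * (2 * ((2 * r) ^+ n * (2 * 2 ^+ j.+1) ^+ n)))%:E)%E).
    rewrite le_eqVlt; apply/orP; left; apply/eqP; congr (_ + _)%E;
      by apply: integral_scaled_tubes => //; rewrite exprn_ge0// invr_ge0.
  rewrite -EFinD lee_fin.
  rewrite le_eqVlt; apply/orP; left; apply/eqP; congr (_ + _).
    have -> : (2 * 2^-1 ^+ j) ^+ n = 2 ^+ n * (2 ^+ n)^-1 ^+ j :> R.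
      by rewrite exprMn !exprVn -!exprM mulnC.
    have -> : rho1 ^+ j = theta ^+ j * (4^-1 ^+ j * (2 ^+ n)^-1 ^+ j).
      by rewrite -!exprMn -invfM.
    rewrite /c1 -/V [theta ^+ j.+1]exprS.
    have ring1 (a b c d e f g : R) :
      a * b * (c * d) * (2 * (e * (f * g))) = a * c * 2 * e * f * (d * (b * g)) by ring.
    exact: ring1.
  have -> : (2 * 2 ^+ j.+1) ^+ n = 4 ^+ n * (2 ^+ n) ^+ j :> R.
    rewrite -exprM (mulnC n) exprM -exprMn; congr (_ ^+ n).
    by rewrite exprS; ring.
  have -> : rho2 ^+ j = (2 ^+ n) ^+ j * theta^-1 ^+ j by rewrite -exprMn.
  have ring2 (a b c d : R) : a * (2 * (b * (c * d))) = 2 * b * c * (d * a) by ring.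
  exact: ring2.
- move=> k; rewrite big_split/=; apply: lerD; exact: sum_geometric_le.
Qed.

End gagliardo_kernel.

(** * Integrable majorants and dominated convergence *)

Section domination.
Context d (T : measurableType d) (R : realType) (mu : {measure set T -> \bar R}).
Implicit Types (f : T -> R) (D : T -> \bar R).

Lemma ge0_integrable_EFin f : measurable_fun setT f -> (forall x, 0 <= f x) ->
  (\int[mu]_x (f x)%:E < +oo)%E -> mu.-integrable setT (EFin \o f).
Proof.
move=> mf f0 foo; apply/integrableP; split; first exact/measurable_EFinP.
by under eq_integral do rewrite gee0_abs ?lee_fin//.
Qed.

Lemma integrable_EFin_lty f : (forall x, 0 <= f x) ->
  mu.-integrable setT (EFin \o f) -> (\int[mu]_x (f x)%:E < +oo)%E.
Proof.
move=> f0 /integrableP[_].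
by under eq_integral do rewrite gee0_abs ?lee_fin//.
Qed.

Lemma dominated_integrable_EFin f D : measurable_fun setT f ->
  mu.-integrable setT D -> (forall x, `|f x|%:E <= D x)%E ->
  mu.-integrable setT (EFin \o f).
Proof.
move=> mf iD fD; apply: le_integrable iD => //; first exact/measurable_EFinP.
by move=> x _; rewrite /= (le_trans (fD x))// lee_abs.
Qed.

Lemma Rintegral_dct (f_ : nat -> T -> R) f D :
  (forall k, measurable_fun setT (f_ k)) -> measurable_fun setT f ->
  {ae mu, forall x, f_ ^~ x @ \oo --> f x} -> mu.-integrable setT D ->
  {ae mu, forall x k, (`|f_ k x|%:E <= D x)%E} ->
  (\int[mu]_x (f_ k x))%R @[k --> \oo] --> (\int[mu]_x (f x))%R.
Proof.
move=> mf_ mf ff iD fD.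
have [|||||ifl _ H] := @dominated_convergence _ T R mu setT measurableT
  (fun k => EFin \o f_ k) (EFin \o f) D.
- by move=> k; exact/measurable_EFinP.
- exact/measurable_EFinP.
- apply: filterS ff => x fx _.
  by apply: cvg_EFin => //; apply: nearW.
- exact: iD.
- by apply: filterS fD => x H k _; exact: H.
apply: (@fine_cvg _ _ _ _ _ (fine (\int[mu]_x (f x)%:E)%E)).
rewrite fineK; last exact: integrable_fin_num.
exact: H.
Qed.

(** D is the sum of the 2^k g_k. The surplus factor 2^k turns the domination into the pointwise rate
    g_k <= 2^-k D, hence into convergence wherever D is finite. *)
Lemma summable_dominator (g : nat -> T -> R) :
  (forall k, measurable_fun setT (g k)) -> (forall k x, 0 <= g k x) ->
  (forall k, (\int[mu]_x (g k x)%:E <= ((4^-1) ^+ k)%:E)%E) ->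
  exists D, [/\ mu.-integrable setT D, forall x, (0 <= D x)%E &
    forall k x, ((2 ^+ k * g k x)%:E <= D x)%E].
Proof.
move=> mg g0 gk.
pose G k x := 2 ^+ k * g k x.
have G0 k x : 0 <= G k x by rewrite mulr_ge0 ?exprn_ge0.
have mG k : measurable_fun setT (G k) by exact: measurable_funM.
have D0 x : (0 <= \sum_(k <oo) (G k x)%:E)%E.
  by apply: nneseries_ge0 => k _ _; rewrite lee_fin.
exists (fun x => \sum_(k <oo) (G k x)%:E)%E; split => //; last first.
  by move=> k x; exact: (@le_nneseries_EFin _ (fun k => G k x)).
apply/integrableP; split; first exact: measurable_nneseries_EFin.
under eq_integral do rewrite gee0_abs//.
apply: (@integral_nneseries_lty _ _ _ _ _ (fun k => 1 * 2^-1 ^+ k) (1 / (1 - 2^-1))) => //.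
  move=> k; under eq_integral do rewrite /G EFinM.
  rewrite ge0_integralZl_EFin ?exprn_ge0//; last 2 first.
  - by move=> x _; rewrite lee_fin.
  - exact/measurable_EFinP.
  apply: (@le_trans _ _ ((2 ^+ k)%:E * ((4^-1) ^+ k)%:E)%E).
    by rewrite lee_pmul2l// lte_fin exprn_gt0.
  rewrite -EFinM lee_fin -exprMn mul1r le_eqVlt; apply/orP; left; apply/eqP.
  by congr (_ ^+ k); field.
move=> k; apply: sum_geometric_le => //; apply/andP; split; first by rewrite invr_ge0.
by rewrite invf_lt1// ltr1n.
Qed.

End domination.

(** * Functions of H^s and pointwise domination *)

Section sobolev_functions.
Context {R : realType} (n : nat) (s : R).
Local Notation mu := (lebesgue_rV R n).
Local Notation mu2 := (lebesgue_rV R n \x lebesgue_rV R n)%E.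
Local Notation K := (gagliardo_kernel s).
Implicit Types (u v : 'rV[R]_n -> R) (x : 'rV[R]_n).

Definition gagliardo u (z : 'rV[R]_n * 'rV[R]_n) : R :=
  (u z.1 - u z.2) ^+ 2 * K z.

Lemma gagliardo_ge0 u z : 0 <= gagliardo u z.
Proof. by rewrite mulr_ge0 ?sqr_ge0 ?gagliardo_kernel_ge0. Qed.

Lemma measurable_diff u : measurable_fun setT u ->
  measurable_fun setT (fun z : 'rV[R]_n * 'rV[R]_n => u z.1 - u z.2).
Proof.
move=> mu'; apply: measurable_funB.
  exact: (measurableT_comp mu' measurable_fst).
exact: (measurableT_comp mu' measurable_snd).
Qed.

Lemma measurable_gagliardo u : measurable_fun setT u ->
  measurable_fun setT (gagliardo u).
Proof.
move=> mu'; apply: measurable_funM; last exact: measurable_gagliardo_kernel.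
by apply: measurable_funX; exact: measurable_diff.
Qed.

Lemma Hs_normsqE u : (Hs_normsq s u =
  \int[mu]_x ((u x) ^+ 2)%:E + \int[mu2]_z (gagliardo u z)%:E)%E.
Proof. by []. Qed.

Lemma Hs_integrable u : Hs s u -> [/\ measurable_fun setT u,
  mu.-integrable setT (EFin \o (fun x => u x ^+ 2)) &
  mu2.-integrable setT (EFin \o gagliardo u)].
Proof.
move=> [mu']; rewrite Hs_normsqE => uoo; split => //.
  apply: ge0_integrable_EFin => //; first exact: measurable_funX.
    by move=> x; exact: sqr_ge0.
  apply: le_lt_trans uoo; rewrite leeDl// integral_ge0// => z _.
  by rewrite lee_fin gagliardo_ge0.
apply: ge0_integrable_EFin => //; first exact: measurable_gagliardo.
  by move=> z; exact: gagliardo_ge0.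
apply: le_lt_trans uoo; rewrite leeDr// integral_ge0// => z _.
by rewrite lee_fin sqr_ge0.
Qed.

(** Pointwise majorants, meant to be shared by a sequence and its limit. They are what survives
    composition with a Lipschitz function. *)
Definition Hs_dominated (D1 : 'rV[R]_n -> \bar R)
    (D2 : 'rV[R]_n * 'rV[R]_n -> \bar R) u := [/\ measurable_fun setT u,
  forall x, ((u x ^+ 2)%:E <= D1 x)%E & forall z, ((gagliardo u z)%:E <= D2 z)%E].

Lemma Hs_dominatedP u : (exists D1 D2, [/\ mu.-integrable setT D1,
    mu2.-integrable setT D2 & Hs_dominated D1 D2 u]) <-> Hs s u.
Proof.
split => [[D1 [D2 [i1 i2 [mu' u1 u2]]]]|].
  split => //; rewrite Hs_normsqE lte_add_pinfty//.
    apply: integrable_EFin_lty; first by move=> x; exact: sqr_ge0.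
    apply: dominated_integrable_EFin i1 _; first exact: measurable_funX.
    by move=> x; rewrite ger0_norm ?sqr_ge0.
  apply: integrable_EFin_lty; first by move=> z; exact: gagliardo_ge0.
  apply: dominated_integrable_EFin i2 _; first exact: measurable_gagliardo.
  by move=> x; rewrite ger0_norm ?gagliardo_ge0.
move=> /Hs_integrable[mu' i1 i2].
by exists (EFin \o (fun x => u x ^+ 2)), (EFin \o gagliardo u).
Qed.

Lemma Hs_le (u v w : 'rV[R]_n -> R) (C : R) : 0 <= C ->
  Hs s u -> Hs s v -> measurable_fun setT w ->
  (forall x, w x ^+ 2 <= C * (u x ^+ 2 + v x ^+ 2)) ->
  (forall z, gagliardo w z <= C * (gagliardo u z + gagliardo v z)) -> Hs s w.
Proof.
move=> C0 /Hs_integrable[mu' u1 u2] /Hs_integrable[mv v1 v2] mw w1 w2.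
apply/Hs_dominatedP.
exists (fun x => C%:E * ((u x ^+ 2)%:E + (v x ^+ 2)%:E))%E.
exists (fun z => C%:E * ((gagliardo u z)%:E + (gagliardo v z)%:E))%E.
split; [| |split => //].
- by apply: integrableZl => //; exact: (integrableD _ u1 v1).
- by apply: integrableZl => //; exact: (integrableD _ u2 v2).
Qed.

Lemma sqrD_le (a b : R) : (a + b) ^+ 2 <= 2 * (a ^+ 2 + b ^+ 2).
Proof. by have := sqr_ge0 (a - b); rewrite sqrrB sqrrD; lra. Qed.

Lemma gagliardoD_le u v z :
  gagliardo (u \+ v) z <= 2 * (gagliardo u z + gagliardo v z).
Proof.
rewrite /gagliardo -mulrDl mulrA ler_wpM2r ?gagliardo_kernel_ge0//.
by apply: le_trans (sqrD_le _ _); rewrite /= [X in X ^+ 2 <= _](_ : _ =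
  (u z.1 - u z.2) + (v z.1 - v z.2))//; ring.
Qed.

Lemma HsD u v : Hs s u -> Hs s v -> Hs s (u \+ v).
Proof.
move=> Hu Hv; apply: (Hs_le (C := 2) _ Hu Hv) => //.
- by apply: measurable_funD; [exact: Hu.1|exact: Hv.1].
- by move=> x; exact: sqrD_le.
- by move=> z; exact: gagliardoD_le.
Qed.

Lemma Cc_smooth_measurable (A : set 'rV[R]_n) u : Cc_smooth A u ->
  measurable_fun setT u.
Proof. by move=> [su _ _]; apply: continuous_measurable_rV; exact: smooth_continuous. Qed.

Lemma Cc_smooth_eq0 (A : set 'rV[R]_n) u x : Cc_smooth A u -> ~ A x -> u x = 0.
Proof.
move=> [_ _ uA] nAx; apply/eqP; apply: contra_notT nAx => ux.
by apply: uA; exact: subset_closure.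
Qed.

Lemma Cc_smooth_sub (A : set 'rV[R]_n) u v : Cc_smooth A u -> smooth v ->
  (forall x, u x = 0 -> v x = 0) -> Cc_smooth A v.
Proof.
move=> [_ cu uA] sv uv.
have sub : closure [set x | v x != 0] `<=` closure [set x | u x != 0].
  by apply: closureS => x /=; apply: contra_neq; exact: uv.
split => //; last exact: subset_trans uA.
by apply: subclosed_compact cu sub; exact: closed_closure.
Qed.

Lemma Cc_smoothD (A : set 'rV[R]_n) u v : Cc_smooth A u -> Cc_smooth A v ->
  Cc_smooth A (u \+ v).
Proof.
move=> [su cu uA] [sv cv vA].
have sub : closure [set x | (u \+ v) x != 0] `<=`
    closure [set x | u x != 0] `|` closure [set x | v x != 0].
  rewrite -closureU; apply: closureS => x /= uvx.
  have [ux|] := eqVneq (u x) 0; last by left.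
  by right; move: uvx; rewrite ux add0r.
split; first exact: smoothD.
  by apply: subclosed_compact (compactU cu cv) sub; exact: closed_closure.
by apply: subset_trans sub _; rewrite subUset.
Qed.

Lemma cube_bump_Hs (p : 'rV[R]_n) (r : R) : 0 < s < 1 -> 0 <= r -> Hs s (cube_bump p r).
Proof.
move=> hs r0.
have mb : measurable_fun setT (cube_bump p r).
  by apply: continuous_measurable_rV; apply: smooth_continuous; exact: smooth_cube_bump.
have b01 x : 0 <= cube_bump p r x <= 1 by rewrite cube_bump_ge0 cube_bump_le1.
split => //; rewrite Hs_normsqE lte_add_pinfty//.
  apply: (@le_lt_trans _ _ (\int[mu]_x (\1_(cube p r) x)%:E)%E).
    apply: ge0_le_integral => //.
    - by move=> x _; rewrite lee_fin sqr_ge0.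
    - by apply/measurable_EFinP; exact: measurable_funX.
    - by apply/measurable_EFinP; apply: measurable_indic; exact: measurable_cube.
    - move=> x _; rewrite lee_fin.
      have [->|xn0] := eqVneq (cube_bump p r x) 0; first by rewrite expr0n.
      rewrite indicE mem_set; last exact: cube_bump_support.
      by have /andP[? ?] := b01 x; rewrite expr_le1.
  rewrite integral_indic ?setIT//; last exact: measurable_cube.
  apply: (@le_lt_trans _ _ ((2 * r) ^+ n)%:E); last exact: ltry.
  by rewrite le_eqVlt; apply/orP; left; apply/eqP; exact: lebesgue_cube.
apply: (@energy_lty _ _ _ hs _ p r (n%:R * 4)) => //.
- by move=> x; exact: cube_bump_support.
- by move=> x y d xy; rewrite -mulrA; exact: cube_bump_lipschitz.
Qed.

End sobolev_functions.

(** * Testing the variational inequality *)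

(** Radius 2^-k in the definition of [Hs_tilde] gives squared distance below 4^-k, so
    [summable_dominator] applies to the squares and to the Gagliardo integrands of z - phi_k. The
    majorants for phi_k itself follow from (a + b)^2 <= 2 (a^2 + b^2). *)
Lemma Hs_tilde_approx (R : realType) n (s : R) (Omega : set 'rV[R]_n)
    (z : 'rV[R]_n -> R) : Hs_tilde s Omega z ->
  exists (phi : nat -> 'rV[R]_n -> R) D1 D2,
  [/\ forall k, Cc_smooth Omega (phi k),
      (lebesgue_rV R n).-integrable setT D1,
      (lebesgue_rV R n \x lebesgue_rV R n)%E.-integrable setT D2,
      Hs_dominated s D1 D2 z /\ forall k, Hs_dominated s D1 D2 (phi k) &
      {ae lebesgue_rV R n, forall x, phi ^~ x @ \oo --> z x}].
Proof.
move=> [Hz zphi].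
have /choice[phi phiP] k : exists phi, Cc_smooth Omega phi /\
    (Hs_normsq s (z \- phi)%R < ((4^-1) ^+ k)%:E)%E.
  have [|phi ? phik] := zphi (2^-1 ^+ k); first by rewrite exprn_gt0// invr_gt0.
  exists phi; split => //; move: phik; rewrite -exprM mulnC exprM.
  by rewrite (_ : 2^-1 ^+ 2 = 4^-1 :> R)// exprVn; congr (_^-1); ring.
have [mz z1 z2] := Hs_integrable Hz.
have mphi k : measurable_fun setT (phi k) by exact: Cc_smooth_measurable (phiP k).1.
have md k : measurable_fun setT (z \- phi k) by exact: measurable_funB.
have [||k|D1 [iD1 D10 gD1]] := @summable_dominator _ _ _ (lebesgue_rV R n)
    (fun k x => (z \- phi k) x ^+ 2).
- by move=> k; exact: measurable_funX.
- by move=> k x; exact: sqr_ge0.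
- apply: le_trans (ltW (phiP k).2); rewrite Hs_normsqE leeDl// integral_ge0// => w _.
  by rewrite lee_fin gagliardo_ge0.
have [||k|D2 [iD2 D20 gD2]] := @summable_dominator _ _ _
    (lebesgue_rV R n \x lebesgue_rV R n)%E (fun k => gagliardo s (z \- phi k)).
- by move=> k; exact: measurable_gagliardo.
- by move=> k x; exact: gagliardo_ge0.
- apply: le_trans (ltW (phiP k).2); rewrite Hs_normsqE leeDr// integral_ge0// => x _.
  by rewrite lee_fin sqr_ge0.
have weight (a : R) k : 0 <= a -> a <= 2 ^+ k * a.
  by move=> a0; rewrite ler_peMl// exprn_ege1// ler1n.
have double (a b : R) (D : \bar R) : (b%:E <= D)%E ->
    ((2 * (a + b))%:E <= 2%:E * (a%:E + D))%E.
  by move=> bD; rewrite EFinM lee_pmul2l// (EFinD a b) leeD2l.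
exists phi, (fun x => 2%:E * ((z x ^+ 2)%:E + D1 x))%E,
  (fun w => 2%:E * ((gagliardo s z w)%:E + D2 w))%E; split.
- by move=> k; have [] := phiP k.
- by apply: integrableZl => //; exact: (integrableD _ z1 iD1).
- by apply: integrableZl => //; exact: (integrableD _ z2 iD2).
- have self (a : R) (b : \bar R) : 0 <= a -> (0 <= b)%E -> (a%:E <= 2%:E * (a%:E + b))%E.
    move=> a0 b0; apply: (@le_trans _ _ (1 * (a%:E + b))%E).
      by rewrite mul1e leeDl.
    by rewrite lee_wpmul2r ?lee_fin ?ler1n// adde_ge0.
  split => [|k].
    split => // [x|w]; apply: self => //; first exact: sqr_ge0.
    exact: gagliardo_ge0.
  have E : phi k = (fun x => z x + (- (z \- phi k) x)).
    by apply/funext => x /=; ring.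
  split => // [x|w].
    apply: (@le_trans _ _ (2 * (z x ^+ 2 + (z \- phi k) x ^+ 2))%:E).
      have := sqrD_le (z x) (- (z x - phi k x)).
      by rewrite sqrrN lee_fin (_ : z x + _ = phi k x)//; ring.
    apply: double; apply: le_trans (gD1 k x).
    by rewrite lee_fin weight ?sqr_ge0.
  apply: (@le_trans _ _ (2 * (gagliardo s z w + gagliardo s (z \- phi k) w))%:E).
    rewrite lee_fin {1}E.
    have -> : gagliardo s (z \- phi k) w = gagliardo s (fun x => - (z \- phi k) x) w.
      by rewrite /gagliardo; congr (_ * _); ring.
    exact: (gagliardoD_le s z (fun x => - (z \- phi k) x)).
  apply: double; apply: le_trans (gD2 k w).
  by rewrite lee_fin weight ?gagliardo_ge0.
- have := integrable_ae measurableT iD1; apply: filterS => x /(_ I) Dx.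
  have zphiM k : (z x - phi k x) ^+ 2 <= fine (D1 x) * 2^-1 ^+ k.
    have := gD1 k x; rewrite -[D1 x]fineK// lee_fin /= mulrC -ler_pdivlMr ?exprn_gt0//.
    by rewrite exprVn.
  apply/cvgrPdist_lt => e e0.
  have h2 : `|2^-1| < 1 :> R by rewrite ger0_norm ?invr_ge0// invf_lt1// ltr1n.
  have /cvgr0Pnorm_lt := cvg_geometric (fine (D1 x)) h2.
  move=> /(_ (e ^+ 2)); rewrite exprn_gt0// => /(_ isT).
  apply: filterS => k /=; have := zphiM k; move=> /le_lt_trans H /ltr_normlW /H.
  by rewrite -real_normK ?num_real// ltr_pXn2r// nnegrE// ltW.
Qed.

Section obstacle.
Context {R : realType} (n : nat) (s c : R).
Local Notation mu := (lebesgue_rV R n).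
Local Notation mu2 := (lebesgue_rV R n \x lebesgue_rV R n)%E.
Implicit Types (u v q f : 'rV[R]_n -> R) (Omega : set 'rV[R]_n).

(** The competitor is u + phi, with quasicontinuous representative g + phi >= g. It keeps the
    exterior datum because phi can be added to the approximants of u - f. *)
Lemma obstacle_solution_test Omega q f (psi : 'rV[R]_n -> \bar R) u phi :
  obstacle_solution s c Omega q f psi u ->
  Cc_smooth Omega phi -> (forall x, 0 <= phi x) -> Hs s phi ->
  0 <= bilinear_form s c Omega q u phi.
Proof.
move=> [[Hu uf [g [gq gu] gpsi]] utest] phiC phi0 Hphi.
have E : (u \+ phi) \- u = phi by apply/funext => x /=; ring.
rewrite -E; apply: utest; split.
- exact: HsD.
- have Euf : (u \+ phi) \- f = (u \- f) \+ phi by apply/funext => x /=; ring.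
  rewrite Euf; split; first by apply: HsD => //; exact: uf.1.
  move=> e e0; have [phi' phi'C phi'e] := uf.2 e e0.
  exists (phi' \+ phi); first exact: Cc_smoothD.
  rewrite (_ : _ \- _ = (u \- f) \- phi')//.
  by apply/funext => x /=; ring.
- exists (g \+ phi); last first.
    move: gpsi => [N N0 gN]; exists N => // x Ox nNx.
    by apply: le_trans (gN x Ox nNx) _; rewrite lee_fin lerDl.
  split; last by apply: filterS gu => x /= ->.
  move=> e e0; have [G [oG Ge cG]] := gq e e0; exists G; split => // x.
  apply: cvgD; first exact: cG.
  have cphi : continuous phi by apply: smooth_continuous; have [] := phiC.
  by have := @continuous_subspaceT _ _ ([set: 'rV[R]_n] `\` G) _ cphi; exact.
Qed.

Definition cross u v (z : 'rV[R]_n * 'rV[R]_n) : R :=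
  (u z.1 - u z.2) * (v z.1 - v z.2) * gagliardo_kernel s z.

Lemma normrM_le_sqr (a b : R) : `|a * b| <= a ^+ 2 + b ^+ 2.
Proof.
rewrite normrM -[a ^+ 2]real_normK ?num_real// -[b ^+ 2]real_normK ?num_real//.
have := sqr_ge0 (`|a| - `|b|); have := normr_ge0 a; have := normr_ge0 b.
by move: `|a| `|b| => x y x0 y0; nra.
Qed.

Lemma cross_le u v z : `|cross u v z| <= gagliardo s u z + gagliardo s v z.
Proof.
rewrite /cross /gagliardo -mulrDl normrM [`|gagliardo_kernel _ _|]ger0_norm ?gagliardo_kernel_ge0//.
by rewrite ler_wpM2r ?gagliardo_kernel_ge0// normrM_le_sqr.
Qed.

Lemma measurable_cross u v : measurable_fun setT u -> measurable_fun setT v ->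
  measurable_fun setT (cross u v).
Proof.
move=> mu' mv; apply: measurable_funM; last exact: measurable_gagliardo_kernel.
by apply: measurable_funM; exact: measurable_diff.
Qed.

Lemma cross_integrable u v : Hs s u -> Hs s v ->
  mu2.-integrable setT (EFin \o cross u v).
Proof.
move=> /Hs_integrable[mu' _ u2] /Hs_integrable[mv _ v2].
apply: dominated_integrable_EFin (integrableD measurableT u2 v2) _.
  exact: measurable_cross.
by move=> z; rewrite /= -EFinD lee_fin cross_le.
Qed.

Lemma bilinear_formE Omega q u v : bilinear_form s c Omega q u v =
  c / 2 * \int[mu2]_z (cross u v z) + \int[mu]_x ((q \_ Omega) x * u x * v x).
Proof.
rewrite /bilinear_form Rintegral_mkcond; congr (_ + Rintegral _ _ _).
apply/funext => x; rewrite /patch; case: ifP => // _; by rewrite !mul0r.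
Qed.

Lemma product_lebesgueE (A B : set 'rV[R]_n) : measurable A -> measurable B ->
  (mu2 (A `*` B) = mu A * mu B)%E.
Proof. by move=> mA mB; exact: product_measure1E. Qed.

Lemma negligible_fst_snd (P : 'rV[R]_n -> Prop) : {ae mu, forall x, P x} ->
  {ae mu2, forall z, P z.1 /\ P z.2}.
Proof.
move=> [N [mN N0 PN]].
exists (N `*` setT `|` setT `*` N); split.
- by apply: measurableU; apply: measurableX.
- apply/eqP; rewrite -measure_le0; apply: le_trans (measureU2 _ _ _) _.
  + exact: measurableX.
  + exact: measurableX.
  + have e1 : mu2 (N `*` setT) = 0%E by rewrite product_lebesgueE// N0 mul0e.
    have e2 : mu2 (setT `*` N) = 0%E by rewrite product_lebesgueE// N0 mule0.
    rewrite -[leRHS]adde0; apply: leeD; rewrite le_eqVlt; apply/orP; left; apply/eqP.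
      exact: e1.
    exact: e2.
- move=> z /= /not_andP[nP|nP]; [left|right]; split => //; exact: PN.
Qed.

(** By |ab| <= a^2 + b^2 the energy integrand is dominated by that of u plus D2, and the potential
    term by M (u^2 + D1); dominated convergence then applies to each. *)
Lemma bilinear_form_limit_ge0 Omega q (M : R) u v (v_ : nat -> 'rV[R]_n -> R) D1 D2 :
  measurable_fun setT (q \_ Omega) ->
  {ae mu, forall x, `|(q \_ Omega) x| <= M} -> Hs s u ->
  mu.-integrable setT D1 -> mu2.-integrable setT D2 ->
  Hs_dominated s D1 D2 v -> (forall k, Hs_dominated s D1 D2 (v_ k)) ->
  {ae mu, forall x, v_ ^~ x @ \oo --> v x} ->
  (forall k, 0 <= bilinear_form s c Omega q u (v_ k)) ->
  0 <= bilinear_form s c Omega q u v.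
Proof.
move=> mq qM Hu iD1 iD2 vD v_D v_v B0.
have [mu' u1 u2] := Hs_integrable Hu.
have mv : measurable_fun setT v by case: vD.
have mv_ k : measurable_fun setT (v_ k) by case: (v_D k).
have cE : (\int[mu2]_z (cross u (v_ k) z))%R @[k --> \oo] --> (\int[mu2]_z (cross u v z))%R.
  apply: (Rintegral_dct (D := fun z => (gagliardo s u z)%:E + D2 z)%E).
  - by move=> k; exact: measurable_cross.
  - exact: measurable_cross.
  - apply: filterS (negligible_fst_snd v_v) => z [z1 z2].
    apply: cvgM; last exact: cvg_cst.
    by apply: cvgM; [exact: cvg_cst|exact: cvgB].
  - exact: (integrableD measurableT u2 iD2).
  - apply: aeW => z k; have [_ _ vk] := v_D k.
    apply: (@le_trans _ _ (gagliardo s u z + gagliardo s (v_ k) z)%:E).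
      by rewrite lee_fin cross_le.
    by rewrite EFinD leeD2l.
have cQ : (\int[mu]_x ((q \_ Omega) x * u x * v_ k x))%R @[k --> \oo] -->
    (\int[mu]_x ((q \_ Omega) x * u x * v x))%R.
  apply: (Rintegral_dct (D := fun x => M%:E * ((u x ^+ 2)%:E + D1 x))%E).
  - by move=> k; apply: measurable_funM => //; exact: measurable_funM.
  - by apply: measurable_funM => //; exact: measurable_funM.
  - apply: filterS v_v => x vx; apply: cvgM => //; exact: cvg_cst.
  - by apply: integrableZl => //; exact: (integrableD _ u1 iD1).
  - apply: filterS qM => x qx k; have [_ vk _] := v_D k.
    have M0 : 0 <= M by exact: le_trans qx.
    apply: (@le_trans _ _ (M * (u x ^+ 2 + v_ k x ^+ 2))%:E).
      rewrite lee_fin -mulrA normrM; apply: ler_pM => //.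
      exact: normrM_le_sqr.
    by rewrite EFinM lee_wpmul2l ?lee_fin// (EFinD (u x ^+ 2)) leeD2l.
rewrite bilinear_formE.
have cB : (c / 2 * (\int[mu2]_z (cross u (v_ k) z)) +
    (\int[mu]_x ((q \_ Omega) x * u x * v_ k x)))%R @[k --> \oo] -->
    (c / 2 * (\int[mu2]_z (cross u v z)) +
    (\int[mu]_x ((q \_ Omega) x * u x * v x)))%R.
  by apply: cvgD => //; apply: cvgM => //; exact: cvg_cst.
rewrite -(cvg_lim (@Rhausdorff R) cB); apply: limr_ge.
  by apply/cvg_ex; eexists; exact: cB.
by apply: nearW => k; have := B0 k; rewrite bilinear_formE.
Qed.

End obstacle.

(** * The two nonlinear test functions *)

Section real_inequalities.
Context {R : realType}.
Implicit Types (a b e r X Y : R).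

(* A smooth approximation of the negative part that, like the negative part
  itself, vanishes at 0, is nonnegative and is Lipschitz, uniformly in [e]. *)
Definition negpart_approx e r : R :=
  (Num.sqrt (r ^+ 2 + e ^+ 2) - r - e) ^+ 2 / (4 * Num.sqrt (r ^+ 2 + e ^+ 2)).

Lemma hypot_gt0 e r : 0 < e -> 0 < Num.sqrt (r ^+ 2 + e ^+ 2).
Proof. by move=> e0; rewrite sqrtr_gt0 ltr_wpDl ?sqr_ge0 ?exprn_gt0. Qed.

Lemma hypot_sqr e r : Num.sqrt (r ^+ 2 + e ^+ 2) ^+ 2 = r ^+ 2 + e ^+ 2.
Proof. by rewrite sqr_sqrtr// addr_ge0 ?sqr_ge0. Qed.

Lemma hypot_ge e r : 0 < e -> e <= Num.sqrt (r ^+ 2 + e ^+ 2).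
Proof.
move=> e0; rewrite -(@ler_pXn2r _ 2)// ?nnegrE ?sqrtr_ge0 ?(ltW e0)//.
by rewrite hypot_sqr lerDr sqr_ge0.
Qed.

Lemma hypot_ge_norm e r : `|r| <= Num.sqrt (r ^+ 2 + e ^+ 2).
Proof.
rewrite -(@ler_pXn2r _ 2)// ?nnegrE ?sqrtr_ge0//.
by rewrite hypot_sqr real_normK ?num_real// lerDl sqr_ge0.
Qed.

Lemma hypot_le e r : 0 < e -> Num.sqrt (r ^+ 2 + e ^+ 2) <= `|r| + e.
Proof.
move=> e0; have r0 := normr_ge0 r.
rewrite -(@ler_pXn2r _ 2)// ?nnegrE ?sqrtr_ge0 ?addr_ge0 ?(ltW e0)//.
rewrite hypot_sqr -[r ^+ 2]real_normK ?num_real//.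
by move: `|r| r0 => x x0; nra.
Qed.

Lemma hypot_lipschitz e a b : 0 < e ->
  `|Num.sqrt (a ^+ 2 + e ^+ 2) - Num.sqrt (b ^+ 2 + e ^+ 2)| <= `|a - b|.
Proof.
move=> e0; have Sa := hypot_gt0 a e0; have Sb := hypot_gt0 b e0.
have ha := hypot_ge_norm e a; have hb := hypot_ge_norm e b.
have sa := hypot_sqr e a; have sb := hypot_sqr e b.
set S := Num.sqrt _ in Sa ha sa *; set T := Num.sqrt _ in Sb hb sb *.
have ST : 0 < S + T by rewrite addr_gt0.
rewrite -(ler_pM2r ST) -{1}(gtr0_norm ST) -normrM.
have -> : (S - T) * (S + T) = (a - b) * (a + b).
  by rewrite -!subr_sqr sa sb; ring.
rewrite normrM ler_wpM2l//.
by apply: le_trans (ler_normD _ _) _; exact: lerD.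
Qed.

Lemma negpart_approx_ge0 e r : 0 <= negpart_approx e r.
Proof. by rewrite divr_ge0 ?sqr_ge0// mulr_ge0 ?sqrtr_ge0. Qed.

Lemma negpart_approx0 e : 0 < e -> negpart_approx e 0 = 0.
Proof.
move=> e0; rewrite /negpart_approx expr0n add0r sqrtr_sqr gtr0_norm//.
by rewrite subr0 subrr expr0n mul0r.
Qed.

(** With S the larger root, the difference is written as 1/(4S) times two terms, bounded by 8 S |a -
    b| and 4 S |a - b|; hence the constant 3, whatever e is. *)
Lemma negpart_approx_lipschitz e a b : 0 < e ->
  `|negpart_approx e a - negpart_approx e b| <= 3 * `|a - b|.
Proof.
move=> e0; wlog ST : a b / Num.sqrt (b ^+ 2 + e ^+ 2) <= Num.sqrt (a ^+ 2 + e ^+ 2).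
  move=> H; have [/H//|/ltW/H] := leP (Num.sqrt (b ^+ 2 + e ^+ 2)) (Num.sqrt (a ^+ 2 + e ^+ 2)).
  by rewrite distrC [`|b - a|]distrC.
have Sa := hypot_gt0 a e0; have Sb := hypot_gt0 b e0.
have ha := hypot_ge_norm e a; have hb := hypot_ge_norm e b.
have ea := hypot_ge a e0; have eb := hypot_ge b e0.
have la := hypot_lipschitz a b e0.
rewrite /negpart_approx.
set S := Num.sqrt _ in Sa ha ea la ST *; set T := Num.sqrt _ in Sb hb eb la ST *.
set A := S - a - e; set B := T - b - e.
have An : `|A| <= 2 * S by move: ha; rewrite !ler_norml /A; lra.
have Bn : `|B| <= 2 * T by move: hb; rewrite !ler_norml /B; lra.
have AB : `|A - B| <= 2 * `|a - b|.
  rewrite (_ : A - B = (S - T) - (a - b)); last by rewrite /A /B; ring.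
  by apply: le_trans (ler_normB _ _) _; lra.
have -> : A ^+ 2 / (4 * S) - B ^+ 2 / (4 * T) =
  (4 * S)^-1 * ((A - B) * (A + B) + (B / T) ^+ 2 * T * (T - S)).
  by field; rewrite !gt_eqF.
rewrite normrM gtr0_norm ?invr_gt0 ?mulr_gt0// ler_pdivrMl ?mulr_gt0//.
have BT : (B / T) ^+ 2 <= 4.
  rewrite -real_normK ?num_real// normrM normfV (gtr0_norm Sb).
  have BT2 : `|B| / T <= 2 by rewrite ler_pdivrMr.
  have -> : 4 = 2 ^+ 2 :> R by ring.
  by rewrite lerXn2r ?nnegrE// divr_ge0// ltW.
apply: le_trans (ler_normD _ _) _.
have h1 : `|(A - B) * (A + B)| <= 8 * S * `|a - b|.
  rewrite normrM.
  have AB' : `|A + B| <= 4 * S by apply: le_trans (ler_normD _ _) _; lra.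
  by have := ler_pM (normr_ge0 _) (normr_ge0 _) AB AB'; lra.
have h2 : `|(B / T) ^+ 2 * T * (T - S)| <= 4 * S * `|a - b|.
  rewrite normrM (distrC T S); apply: ler_pM => //.
  have BT0 : 0 <= (B / T) ^+ 2 by exact: sqr_ge0.
  rewrite ger0_norm; last by apply: mulr_ge0 => //; exact: ltW.
  by apply: ler_pM => //; exact: ltW.
by move: h1 h2; lra.
Qed.

Lemma negpart_approx_le e r : 0 < e -> `|negpart_approx e r| <= 3 * `|r|.
Proof.
move=> e0; have := negpart_approx_lipschitz r 0 e0.
by rewrite negpart_approx0// !subr0.
Qed.

(** The error does not depend on r, so that e and the argument phi_k may go to their limits
    together. *)
Lemma negpart_approx_close e r : 0 < e ->
  `|negpart_approx e r - Num.max (- r) 0| <= 2 * e.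
Proof.
move=> e0; have S0 := hypot_gt0 r e0; have rS := hypot_ge_norm e r.
have eS := hypot_ge r e0; have Sr := hypot_le r e0; have sS := hypot_sqr e r.
rewrite /negpart_approx; set S := Num.sqrt _ in S0 rS eS Sr sS *.
have [r0|r0] := leP 0 r.
  move: rS Sr; rewrite (ger0_norm r0) => rS Sr.
  rewrite (_ : Num.max _ _ = 0); last by apply/max_idPr; lra.
  rewrite subr0 ger0_norm ?divr_ge0 ?sqr_ge0 ?mulr_ge0 ?(ltW S0)//.
  rewrite ler_pdivrMr ?mulr_gt0//; nra.
move: rS Sr; rewrite (ltr0_norm r0) => rS Sr.
rewrite (_ : Num.max _ _ = - r); last by apply/max_idPl; lra.
have -> : (S - r - e) ^+ 2 / (4 * S) - - r = (4 * S)^-1 * ((S - r - e) ^+ 2 + 4 * S * r).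
  by field; rewrite gt_eqF.
rewrite normrM gtr0_norm ?invr_gt0 ?mulr_gt0// ler_pdivrMl ?mulr_gt0//.
rewrite ler_norml; apply/andP; split; nra.
Qed.

(** The logarithmic estimate tests with 1/(u + delta), but the smooth approximants may be negative.
    The denominator 1 + r + r^2 is positive on the whole line, which makes this function smooth,
    bounded and Lipschitz there; its linear term makes it grow at least as fast as r on r >= 0, as
    [barrier_test_le] requires. *)
Definition barrier r : R := (1 + r + r ^+ 2)^-1.

Lemma barrier_den_gt0 r : 0 < 1 + r + r ^+ 2.
Proof. by have := sqr_ge0 (r + 2^-1); rewrite sqrrD; lra. Qed.

Lemma barrier_gt0 r : 0 < barrier r.
Proof. by rewrite invr_gt0 barrier_den_gt0. Qed.

Lemma barrier_le2 r : barrier r <= 2.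
Proof.
rewrite -[leRHS]invrK lef_pV2 ?posrE ?invr_gt0 ?barrier_den_gt0//.
by have := sqr_ge0 (r + 2^-1); rewrite sqrrD; lra.
Qed.

(** With g the barrier, g(a) - g(b) = (b - a)(1 + a + b) g(a) g(b). Split 1 + a + b as (a + 1/2) +
    (b + 1/2) and use |r + 1/2| g(r) <= 1 and g <= 2. *)
Lemma barrier_lipschitz a b : `|barrier a - barrier b| <= 4 * `|a - b|.
Proof.
have Ha := barrier_den_gt0 a; have Hb := barrier_den_gt0 b.
have -> : barrier a - barrier b = (b - a) * ((1 + a + b) * barrier a * barrier b).
  by rewrite /barrier; field; rewrite !gt_eqF.
rewrite normrM mulrC distrC ler_wpM2r//.
have aux r : `|r + 2^-1| * barrier r <= 1.
  rewrite ler_pdivrMr ?barrier_den_gt0// mul1r ler_norml.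
  have := sqr_ge0 (r + 1); have := sqr_ge0 r; rewrite sqrrD; lra.
have ha := aux a; have hb := aux b.
have ga := barrier_gt0 a; have gb := barrier_gt0 b.
have la := barrier_le2 a; have lb := barrier_le2 b.
rewrite -mulrA normrM [`|barrier a * _|]gtr0_norm ?mulr_gt0//.
apply: (@le_trans _ _ ((`|a + 2^-1| + `|b + 2^-1|) * (barrier a * barrier b))).
  rewrite ler_wpM2r// ?mulr_ge0 ?(ltW ga) ?(ltW gb)//.
  have -> : 1 + a + b = (a + 2^-1) + (b + 2^-1) by field.
  exact: ler_normD.
have na := normr_ge0 (a + 2^-1); have nb := normr_ge0 (b + 2^-1).
have h1 : `|a + 2^-1| * barrier a * barrier b <= 1 * 2.
  by apply: ler_pM => //; rewrite ?mulr_ge0 ?(ltW ga) ?(ltW gb).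
have h2 : `|b + 2^-1| * barrier b * barrier a <= 1 * 2.
  by apply: ler_pM => //; rewrite ?mulr_ge0 ?(ltW ga) ?(ltW gb).
by rewrite mulrDl mulrA [X in _ + X](_ : _ = `|b + 2^-1| * barrier b * barrier a);
  [lra|ring].
Qed.

Lemma mul_barrier_le1 r : 0 <= r -> r * barrier r <= 1.
Proof.
by move=> r0; rewrite ler_pdivrMr ?barrier_den_gt0// mul1r; have := sqr_ge0 r; lra.
Qed.

Lemma barrier_decr a b : 0 <= a <= b -> barrier b <= barrier a.
Proof.
move=> /andP[a0 ab]; rewrite lef_pV2 ?posrE ?barrier_den_gt0//.
by rewrite !lerD// lerXn2r ?nnegrE// (le_trans a0).
Qed.

Lemma barrier_continuous : continuous (@barrier).
Proof.
move=> r; apply: cvgV; first by rewrite gt_eqF// barrier_den_gt0.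
apply: cvgD; last exact: exprn_continuous.
by apply: cvgD; [exact: cvg_cst|exact: cvg_id].
Qed.

(* With [Ha = 1 + a + a^2] one has [Ha - Hb >= a - b] for [a >= b >= 0], so this
  follows from the Engel form [X^2/Ha <= Y^2/Hb + (X-Y)^2/(Ha-Hb)] of the
  Cauchy-Schwarz inequality. *)
Lemma barrier_test_le a b X Y : 0 <= a -> 0 <= b ->
  (a - b) * (X ^+ 2 * barrier a - Y ^+ 2 * barrier b) <= (X - Y) ^+ 2.
Proof.
wlog ab : a b X Y / b <= a.
  move=> H a0 b0; have [/H|/ltW/H] := leP b a; first exact.
  move=> /(_ Y X b0 a0); rewrite -[(Y - X) ^+ 2]sqrrN opprB.
  by rewrite -mulrNN !opprB.
move=> a0 b0.
have Ha := barrier_den_gt0 a; have Hb := barrier_den_gt0 b.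
rewrite /barrier; set P := 1 + a + _ in Ha *; set Q := 1 + b + _ in Hb *.
have -> : (a - b) * (X ^+ 2 / P - Y ^+ 2 / Q) =
  ((a - b) * (X ^+ 2 * Q - Y ^+ 2 * P)) / (P * Q) by field; rewrite !gt_eqF.
rewrite ler_pdivrMr ?mulr_gt0//.
pose E := (a - b) * (a + b).
have E0 : 0 <= E by rewrite mulr_ge0 ?subr_ge0 ?addr_ge0.
have D0 : 0 <= a - b by rewrite subr_ge0.
have PE : P = Q + (a - b) + E by rewrite /P /Q /E; ring.
rewrite -subr_ge0.
have -> : (X - Y) ^+ 2 * (P * Q) - (a - b) * (X ^+ 2 * Q - Y ^+ 2 * P) =
  (Q * (X - Y) - (a - b) * Y) ^+ 2 + E * ((X - Y) ^+ 2 * Q + (a - b) * Y ^+ 2).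
  by rewrite PE; ring.
by rewrite addr_ge0 ?sqr_ge0// mulr_ge0// addr_ge0// mulr_ge0 ?sqr_ge0// ltW.
Qed.

(** The pair inequality when the second point is off the support of the cutoff: a g(a) <= 1 absorbs
    the value a, and the term in b is kept, b being later the exterior value that grows with t. *)
Lemma barrier_test_le0 a b X : 0 <= a ->
  (a - b) * (X ^+ 2 * barrier a) <= X ^+ 2 - b * (X ^+ 2 * barrier a).
Proof.
move=> a0; have := mul_barrier_le1 a0; have := sqr_ge0 X.
by move: (X ^+ 2) (barrier a) => x g x0 ag; nra.
Qed.

End real_inequalities.

(** * Comparison of integrals under almost everywhere bounds *)

Section ae_integrals.
Context d (T : measurableType d) (R : realType) (mu : {measure set T -> \bar R}).
Implicit Types (f g : T -> R).

(** Dominated convergence for the constant sequence f contains integrability of f under an almost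
    everywhere bound. *)
Lemma ae_dominated_integrable f (D : T -> \bar R) : measurable_fun setT f ->
  mu.-integrable setT D -> {ae mu, forall x, (`|f x|%:E <= D x)%E} ->
  mu.-integrable setT (EFin \o f).
Proof.
move=> mf iD fD.
have [|||||//] := @dominated_convergence _ T R mu setT measurableT
  (fun=> EFin \o f) (EFin \o f) D.
- by move=> _; exact/measurable_EFinP.
- exact/measurable_EFinP.
- by apply: aeW => x _; exact: cvg_cst.
- exact: iD.
- by apply: filterS fD => x H k _; exact: H.
Qed.

(** Integrability of f is a consequence, not a premise. Since g is nonnegative only almost
    everywhere, the comparison is made with |g|. *)
Lemma ge0_le_Rintegral_ae f g : measurable_fun setT f -> (forall x, 0 <= f x) ->
  mu.-integrable setT (EFin \o g) -> {ae mu, forall x, f x <= g x} ->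
  (\int[mu]_x (f x)%:E <= (\int[mu]_x g x)%R%:E)%E.
Proof.
move=> mf f0 ig fg; have mg := measurable_int _ ig.
rewrite /Rintegral fineK; last exact: integrable_fin_num.
have -> : (\int[mu]_x (g x)%:E = \int[mu]_x `|(g x)%:E|)%E.
  apply: ae_eq_integral => //; first exact: measurableT_comp.
  apply: filterS fg => x fgx _ /=; rewrite ger0_norm//.
  exact: le_trans (f0 x) fgx.
apply: ae_ge0_le_integral => //.
- by move=> x _; rewrite lee_fin.
- exact/measurable_EFinP.
- exact: measurableT_comp.
- apply: filterS fg => x fgx _; rewrite /= lee_fin.
  by apply: le_trans fgx _; exact: ler_norm.
Qed.

Lemma Rintegral_ge0_ae g : mu.-integrable setT (EFin \o g) ->
  {ae mu, forall x, 0 <= g x} -> 0 <= \int[mu]_x g x.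
Proof.
move=> ig g0.
have := @ge0_le_Rintegral_ae (cst 0) g (measurable_cst _) (fun=> lexx 0) ig g0.
by rewrite integral0 lee_fin.
Qed.

Lemma le_Rintegral_ae f g : mu.-integrable setT (EFin \o f) ->
  mu.-integrable setT (EFin \o g) -> {ae mu, forall x, f x <= g x} ->
  \int[mu]_x f x <= \int[mu]_x g x.
Proof.
move=> i1 i2 fg; rewrite -subr_ge0 -RintegralB//; apply: Rintegral_ge0_ae.
  exact: (integrableB measurableT i2 i1).
by apply: filterS fg => x; rewrite subr_ge0.
Qed.

End ae_integrals.

(** * Nonnegativity and the barrier estimate *)

Section supersolutions.
Context {R : realType} (n : nat) (s c : R).
Local Notation mu := (lebesgue_rV R n).
Local Notation mu2 := (lebesgue_rV R n \x lebesgue_rV R n)%E.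
Implicit Types (u v q f : 'rV[R]_n -> R) (Omega A B : set 'rV[R]_n).

Lemma measurable_gt0 u : measurable_fun setT u ->
  measurable [set x : 'rV[R]_n | 0 < u x].
Proof.
move=> mu'; rewrite (_ : mkset _ = u @^-1` `]0, +oo[%classic); last first.
  by apply/seteqP; split => x /=; rewrite in_itv/= andbT.
by rewrite -[X in measurable X]setTI; apply: mu'.
Qed.

(** F vanishes almost everywhere, so the rectangle with sides A and B is null, and its measure is
    the product of theirs. *)
Lemma null_of_product_integral (F : 'rV[R]_n * 'rV[R]_n -> R) A B :
  measurable_fun setT F -> (forall z, 0 <= F z) ->
  (\int[mu2]_z (F z)%:E <= 0)%E -> measurable A -> measurable B ->
  (forall x y, A x -> B y -> 0 < F (x, y)) -> mu B != 0%E -> mu A = 0%E.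
Proof.
move=> mF F0 iF mA mB FAB muB.
have : (\int[mu2]_z `|(F z)%:E| = 0)%E.
  apply/eqP; rewrite eq_le integral_ge0// andbT.
  by under eq_integral do rewrite gee0_abs ?lee_fin//.
move=> /ae_eq_integral_abs; rewrite -/(measurable_fun _ _) => H.
have aF : ae_eq mu2 setT (EFin \o F) (cst 0%E).
  by apply: H => //; exact/measurable_EFinP.
have nAB : mu2.-negligible (A `*` B).
  apply: negligibleS aF => -[x y] /= [Ax By] /(_ I) [] /eqP.
  by rewrite gt_eqF// FAB.
have /eqP : mu2 (A `*` B) = 0%E.
  by apply: measure_negligible => //; exact: measurableX.
by rewrite product_lebesgueE// mule_eq0 (negbTE muB) orbF => /eqP.
Qed.

Lemma potential_integrable Omega q (M : R) u v :
  measurable_fun setT (q \_ Omega) -> {ae mu, forall x, `|(q \_ Omega) x| <= M} ->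
  Hs s u -> Hs s v ->
  mu.-integrable setT (EFin \o (fun x => (q \_ Omega) x * u x * v x)).
Proof.
move=> mq qM /Hs_integrable[mu' u1 _] /Hs_integrable[mv v1 _].
apply: (ae_dominated_integrable (D := fun x => M%:E * ((u x ^+ 2)%:E + (v x ^+ 2)%:E))%E).
- by apply: measurable_funM => //; exact: measurable_funM.
- by apply: integrableZl => //; exact: (integrableD _ u1 v1).
- apply: filterS qM => x qx; rewrite -EFinD -EFinM lee_fin -mulrA normrM.
  apply: ler_pM => //; exact: normrM_le_sqr.
Qed.

Lemma Hs_dominated_Hs D1 D2 u : mu.-integrable setT D1 -> mu2.-integrable setT D2 ->
  Hs_dominated s D1 D2 u -> Hs s u.
Proof. by move=> i1 i2 uD; apply/Hs_dominatedP; exists D1, D2. Qed.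

Lemma smooth_negpart_approx (e : R) u : 0 < e -> smooth u ->
  smooth (negpart_approx e \o u).
Proof.
move=> e0 su.
have sS : smooth (fun x => Num.sqrt (u x ^+ 2 + e ^+ 2)).
  apply: smooth_sqrt => [x|]; first by rewrite ltr_wpDl ?sqr_ge0 ?exprn_gt0.
  apply: (smoothD (u := u \* u) (v := cst (e ^+ 2))); last exact: smooth_cst.
  exact: smoothM.
have sB : smooth (fun x => Num.sqrt (u x ^+ 2 + e ^+ 2) + (-1) * u x + - e).
  apply: (smoothD _ (smooth_cst _)); apply: (smoothD sS).
  by apply: (smoothM (smooth_cst _)).
have sV : smooth (fun x => (4 * Num.sqrt (u x ^+ 2 + e ^+ 2))^-1).
  apply: smoothV => [x|]; first by rewrite mulr_gt0// hypot_gt0.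
  by apply: (smoothM (smooth_cst _)).
rewrite (_ : _ \o _ = ((fun x => Num.sqrt (u x ^+ 2 + e ^+ 2) + (-1) * u x + - e) \*
  (fun x => Num.sqrt (u x ^+ 2 + e ^+ 2) + (-1) * u x + - e)) \*
  (fun x => (4 * Num.sqrt (u x ^+ 2 + e ^+ 2))^-1)).
  exact: (smoothM (smoothM sB sB) sV).
by apply/funext => x; rewrite /= /negpart_approx mulN1r expr2.
Qed.

Lemma smooth_barrier u : smooth u -> smooth (barrier \o u).
Proof.
move=> su; rewrite /barrier; apply: (smoothV (u := fun x => 1 + u x + u x ^+ 2)).
  by move=> x; exact: barrier_den_gt0.
rewrite (_ : (fun x => _) = (cst 1 \+ u) \+ (u \* u)).
  exact: (smoothD (smoothD (smooth_cst 1) su) (smoothM su su)).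
by apply/funext => x /=; rewrite expr2.
Qed.

(** An almost everywhere limit of functions that vanish off Omega, boundary included. *)
Lemma Hs_tilde_eq0_ae Omega u : Hs_tilde s Omega u ->
  {ae mu, forall x, ~ Omega x -> u x = 0}.
Proof.
move=> /Hs_tilde_approx[phi [D1 [D2 [phiC _ _ _ cphi]]]].
apply: filterS cphi => x cx nOx; apply/esym.
rewrite -(cvg_lim (@Rhausdorff R) cx).
apply/esym/cvg_lim => //.
rewrite (_ : phi ^~ x = cst 0); first exact: cvg_cst.
by apply/funext => k /=; exact: (Cc_smooth_eq0 (phiC k)).
Qed.

Context (hc : 0 < c) Omega q (M : R) (mq : measurable_fun setT (q \_ Omega))
  (qM : {ae mu, forall x, `|(q \_ Omega) x| <= M})
  (q0 : {ae mu, forall x, Omega x -> 0 <= q x})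
  (psi : 'rV[R]_n -> \bar R).

(** Testing with the negative part v of z = u - f, which is almost everywhere that of u, makes the
    energy of v nonpositive. So v x = v y for almost all pairs, and v vanishes on the non-null set
    where f > 0. *)
Lemma obstacle_solution_ge0_ae f u : obstacle_solution s c Omega q f psi u ->
  {ae mu, forall x, 0 <= f x} -> {ae mu, forall x, Omega x -> f x = 0} ->
  ~ {ae mu, forall x, f x = 0} -> {ae mu, forall x, 0 <= u x}.
Proof.
move=> usol f0 fO fn0.
have [[Hu uf _] _] := usol.
have z0 := Hs_tilde_eq0_ae uf.
have [phi [D1 [D2 [phiC iD1 iD2 [zD phiD] cphi]]]] := Hs_tilde_approx uf.
set z := u \- f in uf z0 zD cphi *.
pose e (k : nat) : R := k.+1%:R^-1.
have e0 k : 0 < e k by rewrite invr_gt0.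
pose v_ k := negpart_approx (e k) \o phi k.
pose v x := Num.max (- z x) 0.
have mz : measurable_fun setT z by case: zD.
have mv : measurable_fun setT v.
  by apply: measurable_maxr; [exact: measurableT_comp|exact: measurable_cst].
have lip (w w' : 'rV[R]_n -> R) : measurable_fun setT w' -> Hs_dominated s D1 D2 w ->
    (forall x, `|w' x| <= 3 * `|w x|) ->
    (forall x y, `|w' x - w' y| <= 3 * `|w x - w y|) ->
    Hs_dominated s (fun x => 9%:E * D1 x)%E (fun x => 9%:E * D2 x)%E w'.
  move=> mw' [_ w1 w2] ww ww2.
  have sq (a b : R) : `|a| <= 3 * `|b| -> a ^+ 2 <= 9 * b ^+ 2.
    move=> ab; rewrite -[a ^+ 2]real_normK ?num_real// -[b ^+ 2]real_normK ?num_real//.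
    by have := normr_ge0 a; move: `|a| `|b| ab => x y xy x0; nra.
  split => // [x|p].
    apply: (@le_trans _ _ (9 * w x ^+ 2)%:E); first by rewrite lee_fin sq.
    by rewrite EFinM lee_pmul2l.
  apply: (@le_trans _ _ (9 * gagliardo s w p)%:E); last by rewrite EFinM lee_pmul2l.
  by rewrite lee_fin /gagliardo mulrA ler_wpM2r ?gagliardo_kernel_ge0// sq.
have iD1' : mu.-integrable setT (fun x => 9%:E * D1 x)%E by exact: integrableZl.
have iD2' : mu2.-integrable setT (fun x => 9%:E * D2 x)%E by exact: integrableZl.
have v_C k : Cc_smooth Omega (v_ k).
  apply: (Cc_smooth_sub (phiC k)); last by move=> x px; rewrite /v_ /= px negpart_approx0.
  by apply: smooth_negpart_approx => //; have [] := phiC k.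
have v_D k : Hs_dominated s (fun x => 9%:E * D1 x)%E (fun x => 9%:E * D2 x)%E (v_ k).
  apply: (lip _ _ _ (phiD k)); first exact: Cc_smooth_measurable (v_C k).
    by move=> x; exact: negpart_approx_le.
  by move=> x y; exact: negpart_approx_lipschitz.
have vlip (a b : R) : `|Num.max (- a) 0 - Num.max (- b) 0| <= `|a - b|.
  have := ler_norm (a - b); have := ler_norm (b - a); rewrite (distrC b).
  by rewrite ler_norml; case: (leP (- a) 0); case: (leP (- b) 0) => ? ? ? ?;
    apply/andP; split; lra.
have le3 (a : R) : 0 <= a -> a <= 3 * a by lra.
have vD : Hs_dominated s (fun x => 9%:E * D1 x)%E (fun x => 9%:E * D2 x)%E v.
  apply: (lip _ _ mv zD) => [x|x y].
    have h : `|v x| <= `|z x| by have := vlip (z x) 0; rewrite oppr0 maxxx subr0 addr0.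
    by apply: le_trans h (le3 _ (normr_ge0 _)).
  exact: le_trans (vlip _ _) (le3 _ (normr_ge0 _)).
have Hv : Hs s v by exact: Hs_dominated_Hs vD.
have v_v : {ae mu, forall x, v_ ^~ x @ \oo --> v x}.
  apply: filterS cphi => x cx; apply/cvgrPdist_le => r r0.
  have r2 : 0 < r / 4 by rewrite divr_gt0.
  have /cvgrPdist_le/(_ _ r2) near1 := cx.
  have [N Nr] : exists N, N.+1%:R^-1 < r / 4 :> R.
    by have [k] := ltr_add_invr r2; rewrite add0r; exists k.
  near=> k.
  have ke : e k <= r / 4.
    apply: le_trans (ltW Nr); rewrite lef_pV2 ?posrE// ler_nat ltnS.
    by near: k; exact: nbhs_infty_ge.
  have kp : `|z x - phi k x| <= r / 4 by near: k.
  have h1 := vlip (z x) (phi k x).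
  have h2 := negpart_approx_close (phi k x) (e0 k).
  rewrite distrC in h2.
  apply: le_trans (ler_distD (Num.max (- phi k x) 0) _ _) _.
  apply: le_trans (lerD h1 h2) _.
  by lra.
have B0 : 0 <= bilinear_form s c Omega q u v.
  apply: (bilinear_form_limit_ge0 mq qM Hu iD1' iD2' vD v_D v_v) => k.
  apply: (obstacle_solution_test usol (v_C k)).
    by move=> x; exact: negpart_approx_ge0.
  exact: Hs_dominated_Hs (v_D k).
have uv : {ae mu, forall x, [/\ 0 <= v x, 0 < v x -> Omega x /\ u x = - v x &
    v x = 0 -> 0 <= u x]}.
  move: z0 f0 fO; apply: filterS3 => x zx fx fOx.
  have ux : u x = z x + f x by rewrite /z /=; ring.
  rewrite /v; case: (leP (- z x) 0) => h; split => //.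
  - by rewrite ltxx.
  - by move=> _; rewrite ux; lra.
  - exact: ltW.
  - move=> _; have Ox : Omega x.
      by apply: contrapT => /zx zx0; move: h; rewrite zx0 oppr0 ltxx.
    by split => //; rewrite opprK ux fOx// addr0.
  - by move=> z0x; move: h; rewrite z0x ltxx.
(* Where both values of v are positive, u = - v gives equality. Where only one is, u >= 0 at the
   other point gives the inequality. *)
have crossv : {ae mu2, forall p, cross s u v p <= - gagliardo s v p}.
  move: (negligible_fst_snd uv); apply: filterS => -[x y] /= [[vx ux1 ux2] [vy uy1 uy2]].
  rewrite /cross /gagliardo -mulNr ler_wpM2r ?gagliardo_kernel_ge0//=.
  move: vx; rewrite le_eqVlt => /predU1P[vx|vx]; move: vy; rewrite le_eqVlt => /predU1P[vy|vy].
  - by rewrite -vx -vy subrr mulr0 expr0n oppr0.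
  - have ux := ux2 (esym vx); have [_ ->] := uy1 vy; rewrite -vx; nra.
  - have uy := uy2 (esym vy); have [_ ->] := ux1 vx; rewrite -vy; nra.
  - have [_ ->] := ux1 vx; have [_ ->] := uy1 vy; nra.
have Qle : \int[mu]_x ((q \_ Omega) x * u x * v x) <= 0.
  have -> : 0 = \int[mu]_x (cst 0 x) :> R by rewrite /Rintegral integral0.
  apply: le_Rintegral_ae; first exact: (potential_integrable mq qM Hu Hv).
    exact: integrable0.
  move: uv q0; apply: filterS2 => x [vx ux1 _] qx.
  move: vx; rewrite le_eqVlt => /predU1P[<-|vx]; first by rewrite mulr0.
  have [Ox ->] := ux1 vx; rewrite /patch mem_set//= mulrN mulNr oppr_le0.
  by rewrite !mulr_ge0 ?qx// ltW.
have [_ _ gv] := Hs_integrable Hv.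
have gv0 : (\int[mu2]_p (gagliardo s v p)%:E <= 0)%E.
  have : (\int[mu2]_p (gagliardo s v p)%:E <=
      (\int[mu2]_p (- 1 * cross s u v p))%R%:E)%E.
    apply: ge0_le_Rintegral_ae.
    - exact: measurable_gagliardo.
    - by move=> p; exact: gagliardo_ge0.
    - have := integrableZl measurableT (-1) (cross_integrable Hu Hv).
      by apply: eq_integrable.
    - by apply: filterS crossv => p; rewrite mulN1r lerNr.
  move=> /le_trans; apply; rewrite RintegralZl//; last exact: cross_integrable.
  rewrite lee_fin mulN1r oppr_le0.
  move: B0; rewrite bilinear_formE => B0.
  have : 0 <= c / 2 * \int[mu2]_p cross s u v p by lra.
  by rewrite pmulr_rge0// divr_gt0.
have mf : measurable_fun setT f.
  rewrite (_ : f = u \- z); last by apply/funext => x; rewrite /z /=; ring.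
  by apply: measurable_funB => //; exact: Hu.1.
pose A := [set x | 0 < v x].
(* Almost everywhere f > 0 forces x outside Omega, where z = 0; so up to a null set B is the whole
   set where f > 0. *)
pose B := [set x | 0 < f x] `&` [set x | v x <= 0].
have mA : measurable A by exact: measurable_gt0.
have mB : measurable B.
  apply: measurableI; first exact: measurable_gt0.
  rewrite (_ : mkset _ = ~` [set x | 0 < v x]); last first.
    by apply/seteqP; split => x /=; [move=> ?; apply/negP; rewrite -leNgt|
      move=> /negP; rewrite -leNgt].
  by apply: measurableC; exact: measurable_gt0.
have muA : mu A = 0%E.
  apply: (null_of_product_integral (measurable_gagliardo s mv) _ gv0 mA mB).
  - by move=> p; exact: gagliardo_ge0.
  - move=> x y Ax [_ By]; have xy : x != y.
      by apply: contraTneq Ax => ->; rewrite -leNgt.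
    rewrite /gagliardo mulr_gt0 ?gagliardo_kernel_gt0//=.
    by rewrite exprn_even_gt0//= subr_eq0 gt_eqF// (le_lt_trans By).
  - apply: contra_notN fn0 => /eqP B0'.
    have nB : {ae mu, forall x, ~ B x} by exists B; split => // x /= /contrapT.
    near=> x.
    have nBx : ~ B x by near: x.
    have f0x : 0 <= f x by near: x.
    have fOx : Omega x -> f x = 0 by near: x.
    have z0x : ~ Omega x -> z x = 0 by near: x.
    have [/fOx//|nOx] := pselect (Omega x).
    apply/eqP; rewrite eq_le f0x andbT leNgt; apply/negP => fx0.
    by apply: nBx; split => //=; rewrite /v z0x// oppr0 maxxx.
have nA : {ae mu, forall x, ~ A x} by exists A; split => // x /= /contrapT.
move: nA uv; apply: filterS2 => x nAx [vx _]; apply.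
by apply/eqP; rewrite eq_le vx andbT leNgt; exact/negP.
Unshelve. all: by end_near. Qed.

End supersolutions.

Section barrier_estimate.
Context {R : realType} (n : nat) (s c : R).
Local Notation mu := (lebesgue_rV R n).
Local Notation mu2 := (lebesgue_rV R n \x lebesgue_rV R n)%E.
Implicit Types (u v q f : 'rV[R]_n -> R) (Omega : set 'rV[R]_n).

(* The exterior values enter only through the pairs with [eta p.2 = 0], where
  [u p.2 = t * f p.2] contributes to the energy with a sign. *)
Lemma obstacle_barrier_estimate (hc : 0 < c) Omega q (M : R)
    (psi : 'rV[R]_n -> \bar R) f eta :
  measurable_fun setT (q \_ Omega) -> {ae mu, forall x, `|(q \_ Omega) x| <= M} ->
  measurable_fun setT f ->
  {ae mu, forall x, 0 <= f x} -> {ae mu, forall x, Omega x -> f x = 0} ->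
  Cc_smooth Omega eta -> (forall x, 0 <= eta x <= 1) -> Hs s eta ->
  exists C : R, forall (t : R) u, 0 < t ->
    obstacle_solution s c Omega q (fun x => t * f x) psi u ->
    {ae mu, forall x, 0 <= u x} ->
    (\int[mu2]_p (t * (Num.max (f p.2) 0 * eta p.1 ^+ 2 * barrier (u p.1) *
       gagliardo_kernel s p))%:E <= C%:E)%E.
Proof.
move=> mq qM mf f0 fO etaC eta01 Heta.
have [meta eta1 eta2] := Hs_integrable Heta.
(* The energy of eta bounds the nonlocal part. The second term bounds the potential, by |q| <= M and
   u g(u) <= 1 with g the barrier, and 2/c undoes the factor c/2 of the energy. Neither involves t
   or u. *)
exists (\int[mu2]_p gagliardo s eta p + 2 / c * \int[mu]_x (M * eta x ^+ 2)).
move=> t u t0 usol u0.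
have [[Hu uf _] _] := usol.
have z0 := Hs_tilde_eq0_ae uf.
have [phi [D1 [D2 [phiC iD1 iD2 [zD phiD] cphi]]]] := Hs_tilde_approx uf.
set z := u \- _ in uf z0 zD cphi *.
have mz : measurable_fun setT z by case: zD.
have smooth_eta : smooth eta by case: etaC.
pose test (w : 'rV[R]_n -> R) x := eta x ^+ 2 * barrier (w x).
have mbarrier : measurable_fun setT (@barrier R).
  exact: (continuous_measurable_fun barrier_continuous).
have mtest w : measurable_fun setT w -> measurable_fun setT (test w).
  move=> mw; apply: measurable_funM; first exact: measurable_funX.
  exact: measurableT_comp.
(* 32 is 2 times 4^2: the square of a sum of two terms costs 2, and each term has a factor at most
   4, from (X + Y) g <= 4 for values X, Y of eta in [0, 1] and g <= 2, and from the Lipschitz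
   constant of [barrier]. *)
pose D1' x := (32%:E * ((eta x ^+ 2)%:E + D1 x))%E.
pose D2' p := (32%:E * ((gagliardo s eta p)%:E + D2 p))%E.
have iD1' : mu.-integrable setT D1'.
  by apply: integrableZl => //; exact: (integrableD _ eta1 iD1).
have iD2' : mu2.-integrable setT D2'.
  by apply: integrableZl => //; exact: (integrableD _ eta2 iD2).
have testD w : Hs_dominated s D1 D2 w -> Hs_dominated s D1' D2' (test w).
  move=> [mw w1 w2]; split => [|x|p]; first exact: mtest.
    apply: (@le_trans _ _ (32 * (eta x ^+ 2 + w x ^+ 2))%:E); last first.
      by rewrite EFinM lee_pmul2l// (EFinD (eta x ^+ 2)) leeD2l.
    rewrite lee_fin /test.
    have := eta01 x; have := barrier_gt0 (w x); have := barrier_le2 (w x).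
    have := sqr_ge0 (w x); move: (eta x) (barrier (w x)) => e g w0 g2 g0 /andP[e0 e1].
    have h1 : 0 <= e ^+ 2 <= 1 by rewrite sqr_ge0 expr_le1.
    have h2 : g ^+ 2 <= 4 by have -> : 4 = 2 ^+ 2 :> R by [ring|]; rewrite lerXn2r ?nnegrE ?(ltW g0).
    rewrite exprMn; move: h1 h2 (sqr_ge0 g) w0; rewrite [e ^+ 2 ^+ 2]expr2.
    by move: (e ^+ 2) (g ^+ 2) => E G /andP[E0 E1] G4 G0 w0; nra.
  apply: (@le_trans _ _ (32 * (gagliardo s eta p + gagliardo s w p))%:E); last first.
    by rewrite EFinM lee_pmul2l// (EFinD (gagliardo s eta p)) leeD2l.
  rewrite lee_fin /gagliardo -mulrDl mulrA ler_wpM2r ?gagliardo_kernel_ge0//.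
  rewrite /test.
  have bl := barrier_lipschitz (w p.1) (w p.2).
  have := eta01 p.1; have := eta01 p.2.
  have := barrier_gt0 (w p.1); have := barrier_le2 (w p.1).
  move: (eta p.1) (eta p.2) (barrier (w p.1)) (barrier (w p.2)) bl.
  move: (w p.1 - w p.2) => d X Y g g' bl g2 g0 /andP[Y0 Y1] /andP[X0 X1].
  have -> : X ^+ 2 * g - Y ^+ 2 * g' = (X - Y) * ((X + Y) * g) + Y ^+ 2 * (g - g') by ring.
  apply: le_trans (sqrD_le _ _) _.
  have a1 : ((X - Y) * ((X + Y) * g)) ^+ 2 <= 16 * (X - Y) ^+ 2.
    rewrite exprMn mulrC ler_wpM2r ?sqr_ge0//.
    have -> : 16 = 4 ^+ 2 :> R by ring.
    by rewrite lerXn2r ?nnegrE// ?mulr_ge0 ?addr_ge0 ?(ltW g0)//; nra.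
  have a2 : (Y ^+ 2 * (g - g')) ^+ 2 <= 16 * d ^+ 2.
    rewrite exprMn -[leLHS]mulr1 mulrC mulrA mul1r.
    apply: (@le_trans _ _ (1 * (g - g') ^+ 2)).
      by rewrite ler_wpM2r ?sqr_ge0// -exprM expr_le1.
    rewrite mul1r -[(g - g') ^+ 2]real_normK ?num_real// -[d ^+ 2]real_normK ?num_real//.
    have -> : 16 = 4 ^+ 2 :> R by ring.
    by rewrite -exprMn lerXn2r ?nnegrE ?mulr_ge0.
  by move: a1 a2; lra.
have v_C k : Cc_smooth Omega (test (phi k)).
  apply: (Cc_smooth_sub etaC); last by move=> x ex; rewrite /test ex expr0n mul0r.
  rewrite (_ : test _ = (eta \* eta) \* (barrier \o phi k)); last first.
    by apply/funext => x; rewrite /test expr2.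
  apply: smoothM; first exact: smoothM.
  by apply: smooth_barrier; have [] := phiC k.
have v_v : {ae mu, forall x, (fun k => test (phi k) x) @ \oo --> test z x}.
  apply: filterS cphi => x cx; apply: cvgM; first exact: cvg_cst.
  apply: cvgV; first by rewrite gt_eqF// barrier_den_gt0.
  apply: cvgD; first by apply: cvgD => //; exact: cvg_cst.
  by rewrite expr2; under eq_fun do rewrite expr2; exact: cvgM.
have Hv : Hs s (test z) by exact: Hs_dominated_Hs (testD z zD).
have B0 : 0 <= bilinear_form s c Omega q u (test z).
  apply: (bilinear_form_limit_ge0 mq qM Hu iD1' iD2' (testD z zD) _ v_v) => k.
    exact: testD.
  apply: (obstacle_solution_test usol (v_C k)).
    by move=> x; rewrite mulr_ge0 ?sqr_ge0// ltW// barrier_gt0.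
  exact: Hs_dominated_Hs (testD _ (phiD k)).
(* The positive part of f agrees with f almost everywhere and makes the integrand of the estimate
   nonnegative at every point, as [ge0_le_Rintegral_ae] requires. *)
have facts : {ae mu, forall x, [/\ 0 <= u x, test z x = eta x ^+ 2 * barrier (u x),
    Omega x -> Num.max (f x) 0 = 0 &
    ~ Omega x -> eta x = 0 /\ u x = t * Num.max (f x) 0]}.
  have uz : {ae mu, forall x, 0 <= u x /\ (~ Omega x -> z x = 0)}.
    by move: u0 z0; apply: filterS2.
  move: uz f0 fO; apply: filterS3 => x [ux zx] fx fOx.
  have uE : u x = z x + t * f x by rewrite /z /=; ring.
  split => // [|Ox|nOx].
  - have [Ox|nOx] := pselect (Omega x).
      by rewrite uE fOx// mulr0 addr0.
    by rewrite /test (Cc_smooth_eq0 etaC nOx) expr0n !mul0r.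
  - by rewrite fOx// maxxx.
  - split; first exact: (Cc_smooth_eq0 etaC nOx).
    by rewrite uE zx// add0r; congr (_ * _); apply/esym/max_idPl.
have crossv : {ae mu2, forall p, t * (Num.max (f p.2) 0 * eta p.1 ^+ 2 *
    barrier (u p.1) * gagliardo_kernel s p) <=
    gagliardo s eta p - cross s u (test z) p}.
  move: (negligible_fst_snd facts); apply: filterS => -[x y] /=.
  move=> [[ux vx _ _] [uy vy fy ey]].
  rewrite /cross /gagliardo -mulrBl mulrA ler_wpM2r ?gagliardo_kernel_ge0//= vx vy.
  rewrite lerBrDl -lerBrDr.
  (* For y in Omega the left side vanishes and the Cauchy-Schwarz inequality is enough. For y
     outside, the cutoff vanishes and u y = t f y supplies the left side. *)
  have [/fy ->|/ey[-> uyE]] := pselect (Omega y).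
    by rewrite !mul0r mulr0 subr0; exact: barrier_test_le.
  rewrite expr0n mul0r !subr0.
  have -> : t * (Num.max (f y) 0 * eta x ^+ 2 * barrier (u x)) =
    u y * (eta x ^+ 2 * barrier (u x)) by rewrite uyE; ring.
  exact: barrier_test_le0.
have Qle : \int[mu]_x ((q \_ Omega) x * u x * test z x) <= \int[mu]_x (M * eta x ^+ 2).
  apply: le_Rintegral_ae; first exact: (potential_integrable mq qM Hu Hv).
    exact: (integrableZl _ _ eta1).
  move: facts qM; apply: filterS2 => x [ux vx _ _] qx; rewrite vx.
  have := mul_barrier_le1 ux; have := barrier_gt0 (u x) => b0 ub.
  apply: le_trans (ler_norm _) _.
  have -> : (q \_ Omega) x * u x * (eta x ^+ 2 * barrier (u x)) =
    (q \_ Omega) x * ((u x * barrier (u x)) * eta x ^+ 2) by ring.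
  rewrite normrM; apply: ler_pM => //.
  have e0 := sqr_ge0 (eta x).
  rewrite ger0_norm; last by rewrite mulr_ge0// mulr_ge0// ltW.
  by rewrite ler_piMl.
apply: le_trans (ge0_le_Rintegral_ae _ _ _ crossv) _.
- apply: measurable_funM => //; apply: measurable_funM; last exact: measurable_gagliardo_kernel.
  apply: measurable_funM; last first.
    exact: (measurableT_comp mbarrier (measurableT_comp Hu.1 measurable_fst)).
  apply: measurable_funM.
    exact: (measurable_maxr (measurableT_comp mf measurable_snd) (measurable_cst _)).
  by apply: measurable_funX; exact: (measurableT_comp meta measurable_fst).
- move=> p; have e0 := sqr_ge0 (eta p.1); have b0 := ltW (barrier_gt0 (u p.1)).
  have f0' : 0 <= Num.max (f p.2) 0 by rewrite le_max lexx orbT.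
  apply: mulr_ge0; first exact: ltW.
  apply: mulr_ge0; last exact: gagliardo_kernel_ge0.
  by apply: mulr_ge0 => //; exact: mulr_ge0.
- exact: (integrableB measurableT eta2 (cross_integrable Hu Hv)).
rewrite RintegralB//; last exact: cross_integrable.
rewrite lee_fin lerD2l.
move: B0; rewrite bilinear_formE => B0.
have c2 : 0 < c / 2 by rewrite divr_gt0.
rewrite -(ler_pM2l c2) mulrN mulrA (_ : c / 2 * (2 / c) = 1); last first.
  by field; rewrite gt_eqF.
by rewrite mul1r; lra.
Qed.

End barrier_estimate.

(** * Growth in t and the contact set *)

Lemma Lfun_oo_bounded d (T : measurableType d) (R : realType)
    (mu : {measure set T -> \bar R}) (f : T -> R) : f \in Lfun mu +oo%E ->
  measurable_fun setT f /\ exists M : R, {ae mu, forall x, `|f x| <= M}.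
Proof.
move=> fL; split; first by have := sub_Lfun_mfun fL; rewrite inE.
have := sub_Lfun_finLfun fL; rewrite inE /= /finite_norm unlock.
case: ifPn => [_ foo|muT].
  have [M fM] : exists M : R, (ess_sup mu (abse \o (EFin \o f)) <= M%:E)%E.
    move: foo; case: (ess_sup _ _) => [r _|//|_]; first by exists r.
    by exists 0; rewrite leNye.
  exists M; apply: filterS (ess_sup_ge mu (abse \o (EFin \o f))) => x /= fx.
  by rewrite -lee_fin; exact: le_trans fM.
(* Here the whole space is null, so any bound holds almost everywhere. *)
move=> _; exists 0; exists setT; split => //.
by apply/eqP; rewrite -measure_le0 leNgt.
Qed.

Section contact_set.
Context {R : realType} (n : nat) (s c : R).
Local Notation mu := (lebesgue_rV R n).
Local Notation mu2 := (lebesgue_rV R n \x lebesgue_rV R n)%E.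

(** On the exceptional set A one has 0 <= u_j <= m, so the barrier of u_j is at least that of m.
    This leaves a fixed g >= 0 with (j + 1) times its integral at most C for all j, hence of
    integral zero, although g is positive on pairs with x in A and f > 0 at y outside Omega. *)
Lemma bounded_solutions_null (hc : 0 < c) (Omega : set 'rV[R]_n) (q : 'rV[R]_n -> R) (M : R)
    (psi : 'rV[R]_n -> \bar R) (f eta : 'rV[R]_n -> R)
    (u : nat -> 'rV[R]_n -> R) (m : R) :
  measurable_fun setT (q \_ Omega) -> {ae mu, forall x, `|(q \_ Omega) x| <= M} ->
  {ae mu, forall x, Omega x -> 0 <= q x} -> open Omega ->
  measurable_fun setT f -> {ae mu, forall x, 0 <= f x} ->
  {ae mu, forall x, Omega x -> f x = 0} -> ~ {ae mu, forall x, f x = 0} ->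
  Cc_smooth Omega eta -> (forall x, 0 <= eta x <= 1) -> Hs s eta ->
  (forall j, obstacle_solution s c Omega q (fun x => j.+1%:R * f x) psi (u j)) ->
  {ae mu, forall x, ~ (0 < eta x /\ forall j, u j x <= m)}.
Proof.
move=> mq qM q0 oO mf f0 fO fn0 etaC eta01 Heta usol.
have j0 j : 0 < j.+1%:R :> R by [].
have mOmega := open_measurable_rV oO.
have u0 : {ae mu, forall x j, 0 <= u j x}.
  apply: ae_foralln => j.
  apply: (obstacle_solution_ge0_ae (s := s) _ mq qM q0 (usol j)) => //.
  - by apply: filterS f0 => x fx; rewrite mulr_ge0.
  - by apply: filterS fO => x fx Ox; rewrite fx// mulr0.
  - apply: contra_not fn0; apply: filterS => x /eqP.
    by rewrite mulf_eq0 pnatr_eq0 /= => /eqP.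
have mu_ j : measurable_fun setT (u j) by have [[[]]] := usol j.
have meta := Cc_smooth_measurable etaC.
have [C HC] := obstacle_barrier_estimate hc psi mq qM mf f0 fO etaC eta01 Heta.
pose A := [set x | 0 < eta x] `&` \bigcap_j [set x | u j x <= m].
have mle (w : 'rV[R]_n -> R) : measurable_fun setT w -> measurable [set x : 'rV[R]_n | w x <= m].
  move=> mw; rewrite (_ : mkset _ = w @^-1` `]-oo, m]%classic); last first.
    by apply/seteqP; split => x /=; rewrite in_itv.
  by rewrite -[X in measurable X]setTI; apply: mw.
have mA : measurable A.
  apply: measurableI; first exact: measurable_gt0.
  by apply: bigcapT_measurable => j; exact: mle.
pose B := [set x | 0 < f x] `\` Omega.
have mB : measurable B by apply: measurableD => //; exact: measurable_gt0.
pose g (p : 'rV[R]_n * 'rV[R]_n) := Num.max (f p.2) 0 * (eta p.1) ^+ 2 *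
  (barrier m * \1_A p.1) * gagliardo_kernel s p.
have g0 p : 0 <= g p.
  have h1 := sqr_ge0 (eta p.1); have h2 := ltW (barrier_gt0 m).
  have h3 : 0 <= Num.max (f p.2) 0 by rewrite le_max lexx orbT.
  have h4 := gagliardo_kernel_ge0 s p.
  by apply: mulr_ge0 => //; apply: mulr_ge0; apply: mulr_ge0.
have mg : measurable_fun setT g.
  apply: measurable_funM; last exact: measurable_gagliardo_kernel.
  apply: measurable_funM.
    apply: measurable_funM.
      exact: (measurable_maxr (measurableT_comp mf measurable_snd) (measurable_cst _)).
    by apply: measurable_funX; exact: (measurableT_comp meta measurable_fst).
  apply: measurable_funM => //.
  apply: (@measurableT_comp _ _ _ _ _ _ (\1_A : _ -> R) _ fst) => //.
have gle j : (j.+1%:R%:E * \int[mu2]_p (g p)%:E <= C%:E)%E.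
  rewrite -ge0_integralZl_EFin//; last 2 first.
  - by move=> p _; rewrite lee_fin.
  - exact/measurable_EFinP.
  apply: le_trans (HC j.+1%:R (u j) (j0 j) (usol j) _); last first.
    by apply: filterS u0 => x; exact.
  have mbarrier : measurable_fun setT (@barrier R).
    exact: (continuous_measurable_fun barrier_continuous).
  apply: ae_ge0_le_integral => //.
  - by move=> p _; rewrite -EFinM lee_fin mulr_ge0.
  - by under eq_fun do rewrite -EFinM; apply/measurable_EFinP; exact: measurable_funM.
  - move=> p _; rewrite lee_fin.
    have h1 := sqr_ge0 (eta p.1); have h2 := ltW (barrier_gt0 (u j p.1)).
    have h3 : 0 <= Num.max (f p.2) 0 by rewrite le_max lexx orbT.
    have h4 := gagliardo_kernel_ge0 s p.
    apply: mulr_ge0 => //; apply: mulr_ge0 => //; apply: mulr_ge0 => //.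
    exact: mulr_ge0.
  - apply/measurable_EFinP; apply: measurable_funM => //.
    apply: measurable_funM; last exact: measurable_gagliardo_kernel.
    apply: measurable_funM; last first.
      exact: (measurableT_comp mbarrier (measurableT_comp (mu_ j) measurable_fst)).
    apply: measurable_funM.
      exact: (measurable_maxr (measurableT_comp mf measurable_snd) (measurable_cst _)).
    by apply: measurable_funX; exact: (measurableT_comp meta measurable_fst).
  - move: (negligible_fst_snd u0); apply: filterS => p [up _] _.
    rewrite -EFinM lee_fin ler_pM2l// /g ler_wpM2r ?gagliardo_kernel_ge0//.
    apply: ler_wpM2l.
      by rewrite mulr_ge0 ?sqr_ge0// le_max lexx orbT.
    rewrite indicE; have [pA|pA] := boolP (p.1 \in A); last first.
      by rewrite mulr0 ltW// barrier_gt0.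
    rewrite mulr1; apply: barrier_decr; rewrite up/=.
    by move: pA; rewrite inE => -[_]; exact.
have ig : (\int[mu2]_p (g p)%:E <= 0)%E.
  have I0 : (0 <= \int[mu2]_p (g p)%:E)%E.
    by apply: integral_ge0 => p _; rewrite lee_fin.
  (* An infinite integral is excluded by j = 0; a finite positive one by j + 1 > C / I. *)
  move: I0 gle; case: (\int[mu2]_p (g p)%:E)%E => [I|_ /(_ 0%N)|//].
    rewrite !lee_fin => I0 IC; rewrite leNgt; apply/negP => Ipos.
    have [k kC] : exists k : nat, C / I < k.+1%:R.
      exists (Num.bound `|C / I|); apply: le_lt_trans (ler_norm _) _.
      by apply: lt_trans (archi_boundP (normr_ge0 _)) _; rewrite ltr_nat.
    by have := IC k; rewrite -EFinM lee_fin leNgt -ltr_pdivrMr// kC.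
  by rewrite mul1e leye_eq.
have muA : mu A = 0%E.
  apply: (null_of_product_integral mg g0 ig mA mB).
  - move=> x y Ax [fy nOy]; have [etax _] := Ax.
    rewrite /g /= indicE mem_set// mulr1.
    (* The kernel is known to be positive only off the diagonal; eta x > 0 puts x in Omega, and y is
       outside. *)
    have xy : x != y.
      apply: contraTneq etax => ->; rewrite (Cc_smooth_eq0 etaC nOy) ltxx//.
    rewrite mulr_gt0 ?gagliardo_kernel_gt0// mulr_gt0 ?barrier_gt0//.
    by rewrite mulr_gt0 ?exprn_gt0// lt_max fy.
  - apply: contra_notN fn0 => /eqP B0.
    have nB : {ae mu, forall x, ~ B x} by exists B; split => // x /= /contrapT.
    move: nB f0 fO; apply: filterS3 => x nBx fx fOx.
    have [/fOx//|nOx] := pselect (Omega x).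
    apply/eqP; rewrite eq_le fx andbT leNgt; apply/negP => fx0.
    by apply: nBx; split.
exists A; split => // x /= /contrapT[ex ux]; split => // j _; exact: ux.
Qed.

End contact_set.

Theorem proposition5p4 (R : realType) (n : nat) (hn : (2 <= n)%N)
    (Omega : set 'rV[R]_n) (Omega_open : open Omega)
    (Omega_bounded : bounded_set Omega)
    (s : R) (hs : 0 < s < 1)
    (c : R) (hc : fractional_laplacian_constant n s c)
    (q : 'rV[R]_n -> R) (hq : (q \_ Omega) \in Lfun (lebesgue_rV R n) +oo%E)
    (q_ge0 : {ae lebesgue_rV R n, forall x, Omega x -> 0 <= q x})
    (psi : 'rV[R]_n -> \bar R) (hpsi : quasicontinuous_in s Omega psi)
    (f0 : 'rV[R]_n -> R) (hf0 : Hs s f0)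
    (f0_ge0 : exists2 g, quasicontinuous_rep s f0 g &
                qe_in s (~` closure Omega) (fun x => 0 <= g x))
    (f0_supp : ess_support f0 `<=` ~` closure Omega)
    (f0_neq0 : ~ {ae lebesgue_rV R n, forall x, f0 x = 0})
    (hK : forall t : rat, 0 < t ->
      admissible s Omega (fun x => ratr t * f0 x) psi !=set0)
    (u : rat -> 'rV[R]_n -> R)
    (hu : forall t : rat, 0 < t ->
      obstacle_solution s c Omega q (fun x => ratr t * f0 x) psi (u t))
    (ut : rat -> 'rV[R]_n -> R)
    (hut : forall t : rat, 0 < t -> quasicontinuous_rep s (u t) (ut t))
    (psi_fin : {ae lebesgue_rV R n,
      forall x, Omega x -> psi x \is a fin_num}) :
  (lebesgue_rV R n).-negligible
    (Omega `+` \bigcup_(t in [set t : rat | 0 < t])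
       [set x | Omega x /\ (psi x < (ut t x)%:E)%E]).
Proof.
have [mq [M qM]] := Lfun_oo_bounded hq.
have [c0 _] := hc.
have fO : {ae lebesgue_rV R n, forall x, closure Omega x -> f0 x = 0}.
  apply: filterS (ess_support_ae f0) => x fx Ox; apply: fx => /f0_supp.
  exact.
(* The sign is given only in the exterior; on the closure of Omega, whose boundary may have positive
   measure, f0 vanishes by the support condition. *)
have f00 : {ae lebesgue_rV R n, forall x, 0 <= f0 x}.
  have [g [_ gf] /qe_in_ae g0] := f0_ge0.
  move: fO gf g0; apply: filterS3 => x fOx gx g0x.
  have [/fOx ->//|nOx] := pselect (closure Omega x).
  by rewrite -gx; exact: g0x.
have fO' : {ae lebesgue_rV R n, forall x, Omega x -> f0 x = 0}.
  by apply: filterS fO => x fx Ox; apply: fx; exact: subset_closure.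
have t0 (j : nat) : 0 < j.+1%:R :> rat by [].
have usol j : obstacle_solution s c Omega q (fun x => j.+1%:R * f0 x) psi (u j.+1%:R).
  by have := hu _ (t0 j); rewrite ratr_nat.
(* Countably many cubes k and levels m, so that a single null set serves them all; the bumps on
   rational cubes inside Omega are the cutoffs. *)
have null : {ae lebesgue_rV R n, forall x (k m : nat),
    cube (rat_cube n k).1 (rat_cube n k).2 `<=` Omega -> 0 < (rat_cube n k).2 :> R ->
    ~ (0 < cube_bump (rat_cube n k).1 (rat_cube n k).2 x /\
       forall j : nat, u j.+1%:R x <= m%:R)}.
  apply: ae_foralln => k; apply: ae_foralln => m.
  have [kO|nkO] := pselect (cube (rat_cube n k).1 (rat_cube n k).2 `<=` Omega); last first.
    by apply: aeW => x /nkO.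
  have [r0|r0] := ltP 0 ((rat_cube n k).2 : R); last first.
    exact: aeW.
  have := bounded_solutions_null c0 m%:R mq qM q_ge0 Omega_open hf0.1 f00 fO'
    f0_neq0 (cube_bump_Cc_smooth kO)
    (fun x => introT andP (conj (cube_bump_ge0 _ _ x) (cube_bump_le1 _ _ x)))
    (cube_bump_Hs _ hs (ltW r0)) usol.
  by apply: filterS.
have utu : {ae lebesgue_rV R n, forall x (j : nat), ut j.+1%:R x = u j.+1%:R x}.
  by apply: ae_foralln => j; have [_] := hut _ (t0 j).
suff H : {ae lebesgue_rV R n, forall x, ~ (Omega `+`
    \bigcup_(t in [set t : rat | 0 < t]) [set x | Omega x /\ (psi x < (ut t x)%:E)%E]) x}.
  by apply: negligibleS H => x Hx /= /(_ Hx).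
move: null utu psi_fin; apply: filterS3 => x nullx utx psix.
(* The second half of the symmetric difference is empty, the union being contained in Omega. *)
move=> [[Ox nUx]|[[t _ [Ox _]] nOx]]; last exact: nOx.
have psixfin := psix Ox.
have [k [xk kO]] := rat_cube_nbhs Omega_open Ox.
have r0 : 0 < (rat_cube n k).2 :> R.
  (* A coordinate exists since n > 0, and the strict bound on it forces a positive half-side. *)
  by apply: le_lt_trans (xk (Ordinal (ltnW hn))).
have pm : exists m : nat, (psi x <= m%:R%:E)%E.
  exists (Num.bound `|fine (psi x)|); rewrite -[leLHS]fineK// lee_fin.
  exact: le_trans (ler_norm _) (ltW (archi_boundP (normr_ge0 _))).
have [m psim] := pm.
apply: (nullx k m kO r0); split; first exact: cube_bump_gt0.
move=> j; rewrite -utx -lee_fin; apply: le_trans psim; rewrite leNgt.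
apply/negP => psiu; apply: nUx; exists j.+1%:R => //=.
Qed.
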